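(* Let $\$(k)=O(k^s)$ for some $s\ge0$. Let the weights $\gamma$ have finite algorithmic dimension, and let $\mathrm{decay}_\gamma>1$. Let $\mathcal W\subseteq\mathcal U$ have algorithmic dimension $d\in\mathbb N$ and satisfy $\{u\in\mathcal U:\gamma_u>0\}\subseteq\mathcal W$. Assume that for some $\alpha>0$ there exist non-negative constants $c_1,C,\beta_1,\beta_2$ and, for all $n\in\mathbb N$, quadratures $$Q_n(f)=\sum_{i=1}^na^{(n)}_if(t^{(i,n)}),\qquad a_i^{(n)}\in\mathbb R,\ t^{(i,n)}\in D^d,$$ such that $$e((Q_n)_u;H_u)\le c_1C^{|u|}(n+1)^{-\alpha}(1+\ln(n+1))^{\beta_1|u|+\beta_2}\qquad\text{for all }u\subseteq[d].$$ Then the exponent of tractability in the unrestricted subspace sampling model satisfies $$p^{\mathrm{unr}}\le\max\left\{\frac1\alpha,\frac{2\min\{1,s\}}{\mathrm{decay}_\gamma-1}\right\}.$$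
   Context: Setting. $\mathbb N=\{1,2,\dots\}$, $\mathbb N_0=\mathbb N\cup\{0\}$, $[n]=\{1,\dots,n\}$; $\mathcal U$ is the set of all finite subsets of $\mathbb N$. $D\subseteq\mathbb R$ is a Borel set, $K:D\times D\to\mathbb R$ is a measurable, not identically zero reproducing kernel (symmetric, positive semidefinite) with anchor $c\in D$, i.e. $K(c,c)=0$; $H=H(K)$ is its reproducing kernel Hilbert space (RKHS). $\rho$ is a probability measure on $D$ with $M:=\int_DK(x,x)\,\rho(dx)<\infty$ and $C_0:=\int_D\int_DK(x,y)\,\rho(dx)\rho(dy)>0$. For $u\in\mathcal U$ put $K_u(x,y)=\prod_{j\in u}K(x_j,y_j)$ for $x,y\in D^{\mathbb N}$ ($K_\emptyset\equiv1$), $H_u=H(K_u)$; functions in $H_u$ depend only on the coordinates in $u$ and are identified with functions on $D^u$. Weights are families $\gamma=(\gamma_u)_{u\in\mathcal U}$ of non-negative reals with $\sum_u\gamma_uM^{|u|}<\infty$; the set $\mathcal A=\{u\in\mathcal U:\gamma_u>0\}$ is assumed to contain a non-empty set. Let $\mathfrak X=\{x\in D^{\mathbb N}:\sum_{u\in\mathcal A}\gamma_u\prod_{j\in u}K(x_j,x_j)<\infty\}$ and let $\mathcal H_\gamma$ be the RKHS on $\mathfrak X$ with kernel $\sum_{u\in\mathcal A}\gamma_uK_u$. Every $f\in\mathcal H_\gamma$ has a unique representation $f=\sum_{u\in\mathcal A}f_u$, $f_u\in H_u$, and $\|f\|_\gamma^2=\sum_{u\in\mathcal A}\gamma_u^{-1}\|f_u\|_{H_u}^2$.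 $\mu$ is the infinite product of $\rho$ on $D^{\mathbb N}$ (it satisfies $\mu(\mathfrak X)=1$) and $I(f)=\int_{\mathfrak X}f\,d\mu$. Algorithms and errors. For $u\in\mathcal U$, $x\in D^u$, $(x;c)$ is the point of $D^{\mathbb N}$ whose $j$th coordinate is $x_j$ for $j\in u$ and $c$ otherwise. Admissible algorithms: $Q(f)=\sum_{i=1}^na_if(t_{v_i};c)$ with $n\in\mathbb N_0$, $a_i\in\mathbb R$, $v_i\in\mathcal U$, $t_{v_i}\in(D\setminus\{c\})^{v_i}$. $e(Q;\mathcal H_\gamma)=\sup_{\|f\|_\gamma\le1}|I(f)-Q(f)|$. For $u\subseteq[d]$ and $g\in H_u$: $(Q_n)_u(g)=\sum_{i=1}^na_i^{(n)}g(t^{(i,n)}_u)$ with $t^{(i,n)}_u=(t^{(i,n)}_j)_{j\in u}$, and $e((Q_n)_u;H_u)=\sup_{\|g\|_{H_u}\le1}|\int_{D^u}g\,d\rho^u-(Q_n)_u(g)|$. Cost (unrestricted subspace sampling). $\$:\mathbb N_0\to[1,\infty)$ is a non-decreasing cost function and $\mathrm{cost}_{\mathrm{unr}}(Q)=\sum_{i=1}^n\$(|v_i|)$. Tractability. $\mathrm{comp}_{\mathrm{unr}}(\varepsilon)=\inf\{\mathrm{cost}_{\mathrm{unr}}(Q): Q\text{ admissible},\ e(Q;\mathcal H_\gamma)\le\varepsilon\}$; the exponent of (strong) tractability $p^{\mathrm{unr}}$ is the infimum of all $p\ge0$ for which there is $C\ge0$ with $\mathrm{comp}_{\mathrm{unr}}(\varepsilon)\le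 C\varepsilon^{-p}$ for all $\varepsilon>0$. Algorithmic dimension. The algorithmic dimension of $\mathcal W\subseteq\mathcal U$ is the minimal $d\in\mathbb N$ for which there is a map $\phi:\mathbb N\to[d]$ whose restriction to each $u\in\mathcal W$ is injective (if such $d$ exists; then $\mathcal W$ has finite algorithmic dimension). Weights $\gamma$ have finite algorithmic dimension if $\{u:\gamma_u>0\}$ has. Decay. $\widehat\gamma_u=\gamma_uC_0^{|u|}$; $u_1,u_2,\dots$ are the distinct non-empty $u$ with $\gamma_u>0$, ordered so that $\widehat\gamma_{u_1}\ge\widehat\gamma_{u_2}\ge\cdots$; $\mathrm{decay}_\gamma=\sup\{p\in\mathbb R:\lim_{j\to\infty}\widehat\gamma_{u_j}j^p=0\}$ (equal to $\infty$ if there are only finitely many $u_j$). *)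

(* Defs.v *)
From HB Require Import structures.
From mathcomp Require Import all_boot all_order all_algebra finmap.
From mathcomp Require Import all_classical all_reals all_analysis.

Set Implicit Arguments.
Unset Strict Implicit.
Unset Printing Implicit Defensive.

Import Order.TTheory GRing.Theory Num.Theory.
Import numFieldNormedType.Exports.

Local Open Scope classical_set_scope.
Local Open Scope ring_scope.

(* Coordinates are indexed by nat = {0, 1, ...}: the index j here stands for
   the positive integer j + 1. Accordingly {fset nat} is the set of all finite
   sets of coordinates and [d] = {1, ..., d} is {0, ..., d - 1}. *)

Section domain.
Context {R : realType} {D : set R}.

(* D with the trace of the Borel sigma-algebra. Measurable spaces of the library
   are pointed types; the anchor c serves as the point. *)
Definition dom (c : D) : Type := D.

HB.instance Definition _ (c : D) := Choice.on (dom c).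
HB.instance Definition _ (c : D) := isPointed.Build (dom c) c.

Definition dom_incl (c : D) (x : dom c) : measurableTypeR R := set_val x.

HB.instance Definition _ (c : D) :=
  Measurable.copy (dom c) (g_sigma_algebra_preimageType (@dom_incl c)).

End domain.

Definition cylinders (J : Type) {disp} (T : measurableType disp) :
    set (set (J -> T)) :=
  \bigcup_j preimage_set_system setT (fun x : J -> T => x j) measurable.

(* T^J with the product sigma-algebra *)
Definition powT (J : Type) {disp} (T : measurableType disp) :=
  g_sigma_algebraType (@cylinders J disp T).

(* P is the J-fold product of rho. *)
Definition is_product_measure {R : realType} {disp} {T : measurableType disp}
    (rho : probability T R) (J : choiceType) (P : probability (powT J T) R) :=
  forall (F : {fset J}) (A : J -> set T), (forall j, measurable (A j)) ->
    P [set x : J -> T | forall j, j \in F -> A j (x j)]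
    = (\prod_(j <- F) rho (A j))%E.

Section rkhs.
Context {R : realType} {T : Type}.
Implicit Types (K : T -> T -> R) (f g h : T -> R).

Definition psd_kernel K :=
  (forall x y, K x y = K y x) /\
  (forall n (x : 'I_n -> T) (a : 'I_n -> R),
     0 <= \sum_(i < n) \sum_(j < n) a i * a j * K (x i) (x j)).

(* A Hilbert space of functions on T with reproducing kernel K; the fields
   determine rkhs_set, and rkhs_ip on it, uniquely. *)
Record rkhs K := Rkhs {
  rkhs_set : set (T -> R);
  rkhs_ip : (T -> R) -> (T -> R) -> R;
  rkhs0 : rkhs_set (fun=> 0);
  rkhs_lin : forall a f g, rkhs_set f -> rkhs_set g ->
        rkhs_set (fun x => a * f x + g x);
  rkhs_ipC : forall f g, rkhs_set f -> rkhs_set g -> rkhs_ip f g = rkhs_ip g f;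
  rkhs_ip_lin : forall a f g h, rkhs_set f -> rkhs_set g -> rkhs_set h ->
        rkhs_ip (fun x => a * f x + g x) h = a * rkhs_ip f h + rkhs_ip g h;
  rkhs_ip_ge0 : forall f, rkhs_set f -> 0 <= rkhs_ip f f;
  rkhs_ip_def : forall f, rkhs_set f -> rkhs_ip f f = 0 -> f = (fun=> 0);
  rkhs_complete : forall F : nat -> T -> R, (forall n, rkhs_set (F n)) ->
        (forall e : R, 0 < e -> exists N, forall m n, (N <= m)%N -> (N <= n)%N ->
           Num.sqrt (rkhs_ip (F m \- F n) (F m \- F n)) < e) ->
        exists2 f, rkhs_set f &
          Num.sqrt (rkhs_ip (F n \- f) (F n \- f)) @[n --> \oo] --> (0 : R);
  rkhs_section : forall y, rkhs_set (K^~ y);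
  rkhs_reproducing : forall f y, rkhs_set f -> f y = rkhs_ip f (K^~ y)
}.

Definition rkhs_norm K (H : rkhs K) f := Num.sqrt (rkhs_ip H f f).

Definition worst_case_error K (H : rkhs K) (S Q : (T -> R) -> R) : \bar R :=
  ereal_sup [set `|S f - Q f|%:E |
             f in [set f | rkhs_set H f /\ rkhs_norm H f <= 1]].

End rkhs.

(* sum of an absolutely summable real family *)
Definition real_esum {R : realType} {I : choiceType} (S : set I) (F : I -> R) : R :=
  fine (\esum_(i in S) (Num.max (F i) 0)%:E)
  - fine (\esum_(i in S) (Num.max (- F i) 0)%:E).

Section setting.
Context {R : realType} {D : set R} (c : D).
Implicit Types (K : dom c -> dom c -> R) (rho : probability (dom c) R).
Implicit Types (gamma : {fset nat} -> R) (u v : {fset nat}) (x y : nat -> dom c).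

(* the point (t; c) *)
Definition anchored u (t : u -> dom c) : nat -> dom c :=
  fun j => oapp t c (insub j : option u).

Definition prodK K u x y : R := \prod_(j <- u) K (x j) (y j).

Definition diag_mean K rho : R := \int[rho]_x K x x.

Definition double_mean K rho : R := \int[rho]_x \int[rho]_y K x y.

Definition active gamma : set {fset nat} := [set u | 0 < gamma u].

Definition weighted_domain K gamma : set (nat -> dom c) :=
  [set x | (\esum_(u in active gamma) (gamma u * prodK K u x x)%:E < +oo)%E].

Definition weighted_kernel K gamma (x y : weighted_domain K gamma) : R :=
  real_esum (active gamma)
    (fun u => gamma u * prodK K u (set_val x) (set_val y)).

(* Functions on X := weighted_domain K gamma are extended by 0 outside X, to
   be integrated over X and to be evaluated at the points (t; c). The latter
   always lie in X, because prodK K u vanishes on the diagonal at (t; c) unless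
   u is a subset of the finite set of coordinates of t. *)
Definition integral K gamma (mu : probability (powT nat (dom c)) R)
    (f : weighted_domain K gamma -> R) : R :=
  \int[mu]_(x in weighted_domain K gamma) ('valL_ (0 : R) f) x.

Record algorithm := Algorithm {
  alg_size : nat;
  alg_coef : 'I_alg_size -> R;
  alg_supp : 'I_alg_size -> {fset nat};
  alg_pt : forall i, alg_supp i -> dom c;
  alg_pt_neq : forall i (j : alg_supp i), alg_pt j <> c
}.

Definition alg_apply K gamma (Q : algorithm)
    (f : weighted_domain K gamma -> R) : R :=
  \sum_(i < alg_size Q)
     alg_coef i * ('valL_ (0 : R) f) (anchored (@alg_pt Q i)).

Definition cost_unr (cost : nat -> R) (Q : algorithm) : R :=
  \sum_(i < alg_size Q) cost #|` alg_supp i|%fset.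

Section tractability.
Variables (K : dom c -> dom c -> R) (gamma : {fset nat} -> R).
Variables (mu : probability (powT nat (dom c)) R).
Variables (H : rkhs (@weighted_kernel K gamma)) (cost : nat -> R).

Definition alg_error (Q : algorithm) : \bar R :=
  worst_case_error H (@integral K gamma mu) (@alg_apply K gamma Q).

Definition comp_unr (e : R) : \bar R :=
  ereal_inf [set (cost_unr cost Q)%:E | Q in [set Q | (alg_error Q <= e%:E)%E]].

Definition exponent_unr : \bar R :=
  ereal_inf [set p%:E | p in [set p : R | 0 <= p /\
    exists2 C : R, 0 <= C &
      forall e : R, 0 < e -> (comp_unr e <= (C * e `^ (- p))%:E)%E]].

End tractability.

(* The functions in H(prodK K u) depend only on the coordinates in u; such a g
   is identified with the function t |-> g (t; c) on D^u. *)
Definition integral_u u (rhou : probability (powT u (dom c)) R)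
    (g : (nat -> dom c) -> R) : R :=
  \int[rhou]_t g (anchored (t : u -> dom c)).

Definition upto (d : nat) : {fset nat} := [fset j in iota 0 d]%fset.

(* u-projection of the quadrature with coefficients a and nodes t in D^d *)
Definition quad_u d n (a : 'I_n -> R) (t : 'I_n -> upto d -> dom c)
    u (ud : (u `<=` upto d)%fset) (g : (nat -> dom c) -> R) : R :=
  \sum_(i < n) a i * g (anchored (t i \o fincl ud)).

End setting.

Definition separable_by (W : set {fset nat}) (d : nat) :=
  exists phi : nat -> 'I_d, forall u, W u -> {in u &, injective phi}.

Definition algorithmic_dimension (W : set {fset nat}) (d : nat) :=
  [/\ (0 < d)%N, separable_by W d &
      forall d', (0 < d')%N -> separable_by W d' -> (d <= d')%N].

Definition finite_algorithmic_dimension (W : set {fset nat}) :=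
  exists d, algorithmic_dimension W d.

Section decay.
Context {R : realType}.
Implicit Types (gamma : {fset nat} -> R).

Definition scaled_weight gamma (C0 : R) (u : {fset nat}) := gamma u * C0 ^+ #|` u|%fset.

Definition nonempty_active gamma : set {fset nat} :=
  [set u | u != fset0 /\ 0 < gamma u].

Definition decreasing_enum gamma (C0 : R) (e : nat -> {fset nat}) :=
  [/\ injective e, range e = nonempty_active gamma &
      forall i j, (i <= j)%N ->
        scaled_weight gamma C0 (e j) <= scaled_weight gamma C0 (e i)].

(* All decreasing enumerations yield the same sequence of scaled weights, so
   the choice of e is immaterial. *)
Definition decay gamma (C0 : R) : \bar R :=
  if `[< finite_set (nonempty_active gamma) >] then +oo%E else
  ereal_sup [set p%:E | p in [set p : R |
    exists2 e, decreasing_enum gamma C0 e &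
      scaled_weight gamma C0 (e j) * j.+1%:R `^ p @[j --> \oo] --> (0 : R)]].

End decay.

(* Main.v *)
(* On H_gamma the squared worst-case error of a linear functional is obtained by
   applying the functional to both variables of the kernel; it is therefore the
   sum over the active u of gamma_u times the squared error on H_u, and no
   decomposition f = sum f_u is needed. A map phi that is injective on u turns a
   quadrature on D^d into nodes of D^N, whose error on H_u is that of the
   phi(u)-projection of the quadrature.

   The algorithm is multilevel. Let l(u) be the integer part of log_2 of the rank
   of u among the active sets. Level k recovers the components f_u not yet seen
   with l(u) <= k, either (s <= 1) as the difference of the values of f at the
   points truncated to the union of the first 2^k, resp. 2^(k-1), active sets, or
   (s >= 1) by inclusion-exclusion for each u separately, at a cost of order
   2^(k min(1, s)) per node. Let p exceed the claimed bound and choose q with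
   2 min(1, s) / p < q < decay - 1. With tau = q p / 2 and about 2^((L-k) tau)
   nodes on level k <= L, the squared error is O(2^(-L q)), because the sum of
   gamma_u 2^(q l(u)) is finite, and the cost is O(2^(L tau)), the
   order of the error to the power -p. *)
Require Import Defs.
From mathcomp Require Import all_boot all_order all_algebra finmap.
From mathcomp Require Import all_classical all_reals all_analysis.
From mathcomp Require Import measurable_realfun ring lra.

Set Implicit Arguments.
Unset Strict Implicit.
Unset Printing Implicit Defensive.

Import Order.TTheory GRing.Theory Num.Theory.
Import numFieldNormedType.Exports.

Local Open Scope classical_set_scope.
Local Open Scope ring_scope.

(** * Reproducing kernel Hilbert spaces *)

(** Why these parameters: put g = 2^q. As tau = q p / 2 and the quadratures converge at least like
    n^(-1/p), about 2^(j tau) nodes give a squared error of order g^(-j). A component recovered at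
    level lev(u) <= l(u) then contributes gamma_u g^(lev(u) - L), and an unrecovered one only its
    initial error, where g^(l(u) - L) >= 1. Both are within a constant of gamma_u g^(l(u)) g^(-L).
    As min(1, s) < tau, the level costs form a geometric series dominated by level 0. The map into
    [d] also forces |u| <= d on active sets, which bounds C^|u|, the logarithms, C_0^|u| and the
    2^|u| terms of inclusion-exclusion uniformly. The analytic obstacle is that [rkhs] and
    [is_product_measure] are only characterizations: measurability of the functions in a space has
    to come from density of the kernel sections, and integrals of products from the measures of
    boxes. The kernel series is passed through the error functional by dominated convergence, once
    in each variable. *)

Section rkhs_theory.
Context {R : realType} {T : Type} (K : T -> T -> R) (H : rkhs K).
Implicit Types f g h v : T -> R.
Local Notation V := (rkhs_set H).
Local Notation ip := (rkhs_ip H).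
Local Notation nrm := (rkhs_norm H).

Lemma rkhs_setZ a f : V f -> V (a \*o f).
Proof.
move=> Vf; have := rkhs_lin a Vf (rkhs0 H).
by congr V; apply/funext => x; rewrite addr0.
Qed.

Lemma rkhs_setB f g : V f -> V g -> V (f \- g).
Proof.
move=> Vf Vg; have := rkhs_lin (-1) Vg Vf.
by congr V; apply/funext => x; rewrite mulN1r addrC.
Qed.

Lemma rkhs_ip0l h : V h -> ip (fun=> 0) h = 0.
Proof.
move=> Vh; have := rkhs_ip_lin 1 (rkhs0 H) (rkhs0 H) Vh.
rewrite (_ : (fun _ => _) = (fun=> 0 : R)); last first.
  by apply/funext => x; rewrite mulr0 addr0.
lra.
Qed.

Lemma rkhs_ipZl a f h : V f -> V h -> ip (a \*o f) h = a * ip f h.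
Proof.
move=> Vf Vh; rewrite -[RHS]addr0 -(rkhs_ip0l Vh) -rkhs_ip_lin//; last exact: rkhs0.
by congr (ip _ h); apply/funext => x; rewrite addr0.
Qed.

Lemma rkhs_ipBl f g h : V f -> V g -> V h -> ip (f \- g) h = ip f h - ip g h.
Proof.
move=> Vf Vg Vh; rewrite [RHS]addrC -mulN1r -rkhs_ip_lin//.
by congr (ip _ h); apply/funext => x; rewrite mulN1r addrC.
Qed.

Lemma rkhs_ip_sqrD a f g : V f -> V g ->
  ip (fun x => a * f x + g x) (fun x => a * f x + g x)
  = a ^+ 2 * ip f f + 2 * a * ip f g + ip g g.
Proof.
move=> Vf Vg; have Vl := rkhs_lin a Vf Vg.
rewrite rkhs_ip_lin// (rkhs_ipC Vf Vl) (rkhs_ipC Vg Vl).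
rewrite !rkhs_ip_lin// (rkhs_ipC Vg Vf); ring.
Qed.

Lemma rkhs_normE f : V f -> nrm f ^+ 2 = ip f f.
Proof. by move=> Vf; rewrite sqr_sqrtr// rkhs_ip_ge0. Qed.

Lemma rkhs_norm_ge0 f : 0 <= nrm f.
Proof. exact: sqrtr_ge0. Qed.

Lemma rkhs_cauchy_schwarz f g : V f -> V g -> `|ip f g| <= nrm f * nrm g.
Proof.
move=> Vf Vg; rewrite -(ler_pXn2r (n := 2))// ?nnegrE ?normr_ge0 ?mulr_ge0 ?rkhs_norm_ge0//.
rewrite exprMn !rkhs_normE// real_normK ?num_real//.
have [g0|g0] := eqVneq (ip g g) 0.
  by rewrite (rkhs_ip_def Vg g0) (rkhs_ipC Vf (rkhs0 H)) !rkhs_ip0l// ?expr0n/= ?mulr0//; exact: rkhs0.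
have gp : 0 < ip g g by rewrite lt_def g0 rkhs_ip_ge0.
have := rkhs_ip_ge0 (rkhs_lin (- (ip f g / ip g g)) Vg Vf).
rewrite rkhs_ip_sqrD// (rkhs_ipC Vg Vf) => h.
have h2 : 0 <= ip f f - ip f g ^+ 2 / ip g g.
  apply: le_trans h _; rewrite le_eqVlt; apply/orP; left; apply/eqP; field; exact: g0.
by move: h2; rewrite subr_ge0 ler_pdivrMr.
Qed.

Lemma kernel_diag_ge0 y : 0 <= K y y.
Proof. by rewrite (rkhs_reproducing y (rkhs_section H y)) rkhs_ip_ge0 //; exact: rkhs_section. Qed.

Lemma rkhs_eval_le f y : V f -> `|f y| <= nrm f * Num.sqrt (K y y).
Proof.
move=> Vf; rewrite {1}(rkhs_reproducing y Vf).
have Vs := rkhs_section H y.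
rewrite (_ : Num.sqrt (K y y) = nrm (K^~ y)); first exact: rkhs_cauchy_schwarz.
by rewrite /rkhs_norm -(rkhs_reproducing y Vs).
Qed.

Lemma rkhs_cvg_eval (F : nat -> T -> R) h y : (forall n, V (F n)) -> V h ->
  nrm (F n \- h) @[n --> \oo] --> (0 : R) -> F n y @[n --> \oo] --> h y.
Proof.
move=> VF Vh cF; apply/cvgrPdist_lt => e e0.
have cF0 : nrm (F n \- h) * Num.sqrt (K y y) @[n --> \oo] --> (0 : R).
  by rewrite -(mul0r (Num.sqrt (K y y))); apply: cvgM => //; exact: cvg_cst.
move/cvgrPdist_lt : cF0 => /(_ _ e0); apply: filterS => n.
rewrite sub0r normrN => lt; rewrite distrC.
apply: le_lt_trans (rkhs_eval_le y (rkhs_setB (VF n) Vh)) _.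
by apply: le_lt_trans lt; rewrite ler_norm.
Qed.

(* The parallelogram law makes a minimizing sequence of [|v|^2 - 2 l v] in L
   Cauchy; its limit represents l on L. *)
Lemma rkhs_riesz (L : set (T -> R)) (l : (T -> R) -> R) (B : R) :
  L `<=` V -> L (fun=> 0) ->
  (forall a f g, L f -> L g -> L (fun x => a * f x + g x)) ->
  (forall a f g, L f -> L g -> l (fun x => a * f x + g x) = a * l f + l g) ->
  (forall f, L f -> `|l f| <= B * nrm f) ->
  exists h (F : nat -> T -> R),
    [/\ V h, forall n, L (F n), nrm (F n \- h) @[n --> \oo] --> (0 : R) &
        forall v, L v -> ip v h = l v].
Proof.
move=> LV L0 Llin llin lB.
pose J (v : T -> R) : R := ip v v - 2 * l v.
have JB v : L v -> - B ^+ 2 <= J v.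
  move=> Lv; have := lB _ Lv; rewrite /J -rkhs_normE; last exact: LV.
  rewrite ler_norml => /andP[_ h].
  have := sqr_ge0 (nrm v - B); rewrite sqrrB => h2; lra.
have hinf : has_inf [set J v | v in L].
  by split; [exists (J (fun=> 0)); exists (fun=> 0) | exists (- B ^+ 2) => _ [v Lv <-]; exact: JB].
pose m : R := inf [set J v | v in L].
have mJ v : L v -> m <= J v by move=> Lv; apply: ge_inf; [exact: hinf.2 | exists v].
have /choice[F HF] : forall n : nat, exists v, L v /\ (J v < m + n.+1%:R^-1 :> R).
  move=> n; have [|_ [v Lv <-] lt] := @inf_adherent _ _ n.+1%:R^-1 _ hinf; first by rewrite invr_gt0.
  by exists v.
have LF n : L (F n) by have [] := HF n.
have VF n : V (F n) by exact: LV.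
have par u v : L u -> L v -> ip (u \- v) (u \- v) <= 2 * (J u - m) + 2 * (J v - m).
  move=> Lu Lv; have Vu := LV _ Lu; have Vv := LV _ Lv.
  have Lw := Llin 2^-1 _ _ Lu (Llin 2^-1 _ _ Lv L0).
  have Vv0 := LV _ (Llin 2^-1 _ _ Lv L0).
  have := mJ _ Lw; rewrite /J rkhs_ip_sqrD// rkhs_ip_sqrD//; last exact: rkhs0.
  rewrite (llin 2^-1 _ _ Lu (Llin 2^-1 _ _ Lv L0)) (llin 2^-1 _ _ Lv L0).
  rewrite (rkhs_ipC Vu Vv0) rkhs_ip_lin//; last exact: rkhs0.
  have l0 : l (fun=> 0) = 0.
    by apply/eqP; rewrite -normr_le0; apply: le_trans (lB _ L0) _; rewrite /rkhs_norm rkhs_ip0l ?sqrtr0 ?mulr0//; exact: rkhs0.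
  rewrite (rkhs_ip0l Vu) (rkhs_ipC Vv (rkhs0 H)) (rkhs_ip0l Vv) rkhs_ip0l; last exact: rkhs0.
  rewrite l0.
  have -> : ip (u \- v) (u \- v) = ip u u - 2 * ip v u + ip v v.
    have -> : u \- v = (fun x => -1 * v x + u x) by apply/funext => x; rewrite mulN1r addrC.
    by rewrite rkhs_ip_sqrD//; ring.
  lra.
have cau (e : R) : 0 < e -> exists N, forall i j, (N <= i)%N -> (N <= j)%N -> nrm (F i \- F j) < e.
  move=> e0.
  have e2 : 0 < e ^+ 2 / 4 by rewrite divr_gt0// exprn_gt0.
  have [N _ HN] : \forall n \near \oo, n.+1%:R^-1 < e ^+ 2 / 4 := near_infty_natSinv_lt (PosNum e2).
  exists N => i j Ni Nj; rewrite -(ltr_pXn2r (n := 2))// ?nnegrE ?rkhs_norm_ge0 ?(ltW e0)//.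
  rewrite rkhs_normE; last exact: rkhs_setB.
  apply: le_lt_trans (par _ _ (LF i) (LF j)) _.
  have hi : i.+1%:R^-1 < e ^+ 2 / 4 :> R := HN _ Ni.
  have hj : j.+1%:R^-1 < e ^+ 2 / 4 :> R := HN _ Nj.
  have [_ hFi] := HF i; have [_ hFj] := HF j.
  have aux (b x1 x2 x3 x4 y : R) : x1 < y / 4 -> x2 < y / 4 -> x3 < b + x1 -> x4 < b + x2 ->
    2 * (x3 - b) + 2 * (x4 - b) < y by lra.
  exact: aux hi hj hFi hFj.
have [h Vh ch] := rkhs_complete VF cau.
exists h, F; split => // v Lv; have Vv := LV _ Lv.
(* First-order optimality, made quantitative: [F n] is compared with its perturbation by a multiple
   of [v]. The factor - x / (1 + ip v v) nearly minimizes the resulting quadratic; the summand 1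
   keeps the denominator positive when v = 0. *)
have key n : (ip (F n) v - l v) ^+ 2 <= (1 + ip v v) * n.+1%:R^-1.
  set x := ip (F n) v - l v.
  have N0 : 0 < 1 + ip v v by rewrite ltr_pwDl// rkhs_ip_ge0.
  have := mJ _ (Llin (- (x / (1 + ip v v))) _ _ Lv (LF n)); rewrite /J rkhs_ip_sqrD// llin//.
  have [_ +] := HF n; rewrite /J => h1 h2.
  have h3 : 0 <= (- (x / (1 + ip v v))) ^+ 2 * ip v v + 2 * (- (x / (1 + ip v v))) * x + n.+1%:R^-1.
    have aux (b A q s k r p z y : R) : b <= A + q * s + p - 2 * (r * k + z) -> p - 2 * z < b + y -> q = 2 * r ->
      0 <= A + q * (s - k) + y.
      by move=> h3 h4 e; subst q; lra.
    have xE : ip v (F n) - l v = x by rewrite /x (rkhs_ipC Vv (VF n)).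
    by rewrite -[X in 2 * _ * X]xE; exact: aux h2 h1 (erefl _).
  have : x ^+ 2 / (1 + ip v v) <= n.+1%:R^-1.
    rewrite -subr_ge0; apply: le_trans h3 _.
    rewrite -subr_ge0.
    rewrite (_ : _ - _ = (x / (1 + ip v v)) ^+ 2); first exact: sqr_ge0.
    by field; rewrite gt_eqF//= nat1r pnatr_eq0.
  by rewrite ler_pdivrMr// mulrC.
have c1 : ip (F n) v @[n --> \oo] --> ip h v.
  apply/cvgrPdist_lt => e e0.
  have cF0 : nrm (F n \- h) * nrm v @[n --> \oo] --> (0 : R).
    by rewrite -(mul0r (nrm v)); apply: cvgM => //; exact: cvg_cst.
  move/cvgrPdist_lt : cF0 => /(_ _ e0); apply: filterS => n.
  rewrite sub0r normrN => lt; rewrite distrC -rkhs_ipBl//.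
  apply: le_lt_trans (rkhs_cauchy_schwarz (rkhs_setB (VF n) Vh) Vv) _.
  by apply: le_lt_trans lt; rewrite ler_norm.
have c2 : (ip (F n) v - l v) ^+ 2 @[n --> \oo] --> (ip h v - l v) ^+ 2.
  by rewrite !expr2; apply: cvgM; apply: cvgB => //; exact: cvg_cst.
have c3 : (1 + ip v v) * n.+1%:R^-1 @[n --> \oo] --> (0 : R).
  rewrite -(mulr0 (1 + ip v v)); apply: cvgM; first exact: cvg_cst.
  exact: cvg_harmonic.
have : (ip h v - l v) ^+ 2 <= 0.
  by apply: ler_cvg_to c2 c3 _; exact: nearW.
move=> le0; rewrite (rkhs_ipC Vv Vh).
have : (ip h v - l v) ^+ 2 == 0 by rewrite eq_le le0 sqr_ge0.
by rewrite sqrf_eq0 subr_eq0 => /eqP.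
Qed.

(** Riesz representation of <., f> on L = V ∩ P yields the projection h of f onto the closure of L.
    All sections lie in L, so h and f agree at every point by reproduction. Properties stable under
    pointwise limits, such as measurability, thus pass from the sections to the whole space. *)
Lemma rkhs_section_density (P : set (T -> R)) f :
  P (fun=> 0) -> (forall a g h, P g -> P h -> P (fun x => a * g x + h x)) ->
  (forall y, P (K^~ y)) -> V f ->
  exists F : nat -> T -> R, (forall n, P (F n)) /\
    forall y, F n y @[n --> \oo] --> f y.
Proof.
move=> P0 Plin Psec Vf.
have [|||||h [F [Vh LF cF hl]]] := @rkhs_riesz (V `&` P) (ip ^~ f) (nrm f).
- by move=> ? [].
- by split => //; exact: rkhs0.
- by move=> a g h [Vg Pg] [Vh Ph]; split; [exact: rkhs_lin | exact: Plin].
- by move=> a g h [Vg _] [Vh _]; rewrite rkhs_ip_lin.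
- by move=> g [Vg _]; rewrite mulrC; exact: rkhs_cauchy_schwarz.
exists F; split => [n|y]; first by have [] := LF n.
have VF n : V (F n) by have [] := LF n.
suff -> : f y = h y by exact: rkhs_cvg_eval.
have Vy := rkhs_section H y.
by rewrite (rkhs_reproducing y Vf) (rkhs_reproducing y Vh) (rkhs_ipC Vf Vy) (rkhs_ipC Vh Vy) hl.
Qed.

End rkhs_theory.

(** Trades the square root in the pointwise bound [rkhs_eval_le] for an affine expression, so that
    integrability of the diagonal is enough to dominate every function of the space. *)
Lemma sqrt_le_half {R : realType} (k : R) : 0 <= k -> Num.sqrt k <= 2^-1 * (1 + k).
Proof. by move=> k0; have := sqr_ge0 (Num.sqrt k - 1); rewrite sqrrB sqr_sqrtr//; lra. Qed.

Lemma rkhs_kernel_le {R : realType} {T : Type} (K : T -> T -> R) (H : rkhs K) x y :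
  `|K x y| <= 2^-1 * (K x x + K y y).
Proof.
have Vy := rkhs_section H y.
have ny : rkhs_norm H (K^~ y) = Num.sqrt (K y y).
  by rewrite /rkhs_norm -(rkhs_reproducing y Vy).
have := rkhs_eval_le x Vy; rewrite ny => /le_trans; apply.
have /= := sqr_ge0 (Num.sqrt (K x x) - Num.sqrt (K y y)).
by rewrite sqrrB !sqr_sqrtr ?(kernel_diag_ge0 H)//; lra.
Qed.

(** * Error functionals of quadratures and their representers *)

Section rkhs_quadrature.
Context {R : realType} {T : Type} (K : T -> T -> R) (H : rkhs K).
Context {disp} {Om : measurableType disp} (P : probability Om R).
Context (X : set Om) (tau : Om -> T).
Hypothesis mX : measurable X.
Hypothesis msec : forall y, measurable_fun X (fun w => K (tau w) y).
Hypothesis idiag : P.-integrable X (fun w => (K (tau w) (tau w))%:E).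
Implicit Types (f g h : T -> R) (r : seq (R * T)).
Local Notation V := (rkhs_set H).
Local Notation nrm := (rkhs_norm H).

(** The map [tau] from the sample space to the domain of the kernel lets one definition serve D^u
    (through [anchored]), the weighted domain inside D^N, and a single coordinate. *)
Definition quad_error r f : R :=
  \int[P]_(w in X) f (tau w) - \sum_(p <- r) p.1 * f p.2.

Lemma rkhs_measurable f : V f -> measurable_fun X (f \o tau).
Proof.
move=> Vf.
have [||||F [mF cF]] := @rkhs_section_density _ _ K H (fun g => measurable_fun X (g \o tau)) f.
- exact: measurable_cst.
- move=> a g h mg mh /=; apply: measurable_funD => //.
  by apply: measurable_funM => //; exact: measurable_cst.
- by move=> y; exact: msec.
- by [].
by apply: (measurable_fun_cvg mF) => w _; exact: cF.
Qed.

Lemma integrable_one_plus_diag :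
  P.-integrable X (EFin \o (fun w => 2^-1 * (1 + K (tau w) (tau w)))).
Proof.
apply: (@eq_integrable _ _ _ _ _ mX (fun w => (2^-1)%:E * (1%:E + (K (tau w) (tau w))%:E))%E).
  by move=> w _ /=; rewrite EFinM EFinD.
apply: integrableZl => //; apply: integrableD => //.
exact: (finite_measure_integrable_cst P 1 mX).
Qed.

Lemma rkhs_eval_le_half f y : V f -> `|f y| <= nrm f * (2^-1 * (1 + K y y)).
Proof.
move=> Vf; apply: le_trans (rkhs_eval_le y Vf) _.
by rewrite ler_wpM2l ?rkhs_norm_ge0// sqrt_le_half// (kernel_diag_ge0 H).
Qed.

Lemma rkhs_integrable f : V f -> P.-integrable X (EFin \o (f \o tau)).
Proof.
move=> Vf.
apply: (@le_integrable _ _ _ _ _ mX _ (EFin \o (fun w => nrm f * (2^-1 * (1 + K (tau w) (tau w)))))).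
- by apply/measurable_EFinP; exact: rkhs_measurable.
- move=> w _; rewrite /= lee_fin.
  by apply: le_trans (rkhs_eval_le_half _ Vf) _; exact: ler_norm.
- by apply: (integrableZl mX (nrm f) integrable_one_plus_diag).
Qed.

Lemma quad_error_lin r a f g : V f -> V g ->
  quad_error r (fun x => a * f x + g x) = a * quad_error r f + quad_error r g.
Proof.
move=> Vf Vg; rewrite /quad_error.
rewrite RintegralD//; last 2 first.
- have /= := rkhs_integrable (rkhs_setZ a Vf); exact.
- exact: rkhs_integrable.
rewrite RintegralZl//; last exact: rkhs_integrable.
rewrite (eq_bigr (fun p => a * (p.1 * f p.2) + p.1 * g p.2)); last first.
  by move=> p _; rewrite mulrDr mulrCA.
rewrite big_split/= -mulr_sumr; ring.
Qed.

Definition quad_error_cst r : R :=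
  \int[P]_(w in X) (2^-1 * (1 + K (tau w) (tau w)))
  + \sum_(p <- r) `|p.1| * (2^-1 * (1 + K p.2 p.2)).

Lemma quad_error_bounded r f : V f -> `|quad_error r f| <= quad_error_cst r * nrm f.
Proof.
move=> Vf; rewrite /quad_error_cst mulrDl.
apply: le_trans (ler_normB _ _) _; apply: lerD.
  apply: le_trans (le_normr_Rintegral mX (rkhs_integrable Vf)) _.
  rewrite mulrC -RintegralZl//; last exact: integrable_one_plus_diag.
  apply: le_Rintegral => //.
  - exact: (integrable_norm (rkhs_integrable Vf)).
  - by apply: (integrableZl mX (nrm f) integrable_one_plus_diag).
  - by move=> w _; exact: rkhs_eval_le_half.
apply: le_trans (ler_norm_sum _ _ _) _.
rewrite mulr_suml; apply: ler_sum => p _.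
by rewrite normrM -mulrA ler_wpM2l// mulrC rkhs_eval_le_half.
Qed.

(** The bound by [quad_error_cst] need not be sharp: it only has to make Riesz representation
    available. Testing the representer against the sections then makes it explicit. *)
Lemma quad_error_representer r :
  exists h, [/\ V h, forall f, V f -> rkhs_ip H f h = quad_error r f,
    h = (fun y => quad_error r (K^~ y)) &
    nrm h ^+ 2 = quad_error r (fun y => quad_error r (K^~ y))].
Proof.
have [|||||h [_ [Vh _ _ hl]]] := @rkhs_riesz _ _ _ H V (quad_error r) (quad_error_cst r).
- by [].
- exact: rkhs0.
- by move=> a f g Vf Vg; exact: rkhs_lin.
- by move=> a f g Vf Vg; exact: quad_error_lin.
- by move=> f Vf; exact: quad_error_bounded.
have hE : h = (fun y => quad_error r (K^~ y)).
  apply/funext => y; have Vy := rkhs_section H y.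
  by rewrite (rkhs_reproducing y Vh) (rkhs_ipC Vh Vy) hl.
by exists h; split => //; rewrite -hE rkhs_normE// hl.
Qed.

Lemma worst_case_error_le r (S Q : (T -> R) -> R) (E : R) :
  (forall f, V f -> S f - Q f = quad_error r f) -> 0 <= E ->
  quad_error r (fun y => quad_error r (K^~ y)) <= E ^+ 2 ->
  (worst_case_error H S Q <= E%:E)%E.
Proof.
move=> SQ E0 le; apply: ub_ereal_sup => _ [f [Vf nf] <-].
have [h [Vh hl _ hn]] := quad_error_representer r.
rewrite SQ// -hl// lee_fin.
apply: le_trans (rkhs_cauchy_schwarz Vf Vh) _.
apply: le_trans (ler_wpM2r (rkhs_norm_ge0 _ _) nf) _; rewrite mul1r.
by rewrite -(ler_pXn2r (n := 2))// ?nnegrE ?rkhs_norm_ge0// hn.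
Qed.

(** The normalized representer attains the worst case. This direction is what turns the assumed
    error bounds of the quadratures into bounds on the twice applied functional. *)
Lemma worst_case_error_ge r (S Q : (T -> R) -> R) (E : R) :
  (forall f, V f -> S f - Q f = quad_error r f) -> 0 <= E ->
  (worst_case_error H S Q <= E%:E)%E ->
  quad_error r (fun y => quad_error r (K^~ y)) <= E ^+ 2.
Proof.
move=> SQ E0 le.
have [h [Vh hl _ hn]] := quad_error_representer r.
rewrite -hn ler_pXn2r ?nnegrE ?rkhs_norm_ge0//.
have [->//|n0] := eqVneq (nrm h) 0.
have np : 0 < nrm h by rewrite lt_def n0 rkhs_norm_ge0.
have Vu := rkhs_setZ (nrm h)^-1 Vh.
have nu : nrm ((nrm h)^-1 \*o h) <= 1.
  rewrite -(ler_pXn2r (n := 2))// ?nnegrE ?rkhs_norm_ge0// rkhs_normE//.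
  rewrite rkhs_ipZl// (rkhs_ipC Vh Vu) rkhs_ipZl// -rkhs_normE// expr1n.
  by rewrite le_eqVlt; apply/orP; left; apply/eqP; field.
rewrite -lee_fin; apply: le_trans le; apply: ereal_sup_ubound.
exists ((nrm h)^-1 \*o h); first by split.
rewrite SQ// -hl// rkhs_ipZl// -rkhs_normE// ger0_norm; first by congr (_%:E); field.
by rewrite mulr_ge0 ?invr_ge0 ?sqr_ge0 ?rkhs_norm_ge0.
Qed.

End rkhs_quadrature.

(** * Integrals of products over product spaces *)

Section independent_factor.
Context {R : realType} {d1 d2} {Om : measurableType d1} {T : measurableType d2}.
Context (P : {measure set Om -> \bar R}) (rho : {measure set T -> \bar R}).
Context (X : Om -> T) (G : Om -> R) (k : \bar R).
Hypothesis mX : measurable_fun setT X.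
Hypothesis mG : measurable_fun setT G.
Hypothesis G0 : forall w, 0 <= G w.
Hypothesis kfin : k \is a fin_num.
Hypothesis indicator_case : forall A, measurable A ->
  (\int[P]_w (\1_A (X w) * G w)%:E = rho A * k)%E.

Import HBNNSimple.

Let simple_case (h : {nnsfun T >-> R}) :
  (\int[P]_w (h (X w) * G w)%:E = (\int[rho]_x (h x)%:E) * k)%E.
Proof.
transitivity (\int[P]_w
    (\sum_(y \in range h) y%:E * (\1_(h @^-1` [set y]) (X w) * G w)%:E))%E.
  apply: eq_integral => w _; rewrite {1}(fimfunE h) EFinM -fsumEFin//.
  rewrite ge0_mule_fsuml; last by move=> y; exact: nnfun_muleindic_ge0.
  by apply: eq_fsbigr => y _; rewrite !EFinM muleA.
have m1 y : measurable_fun setT (fun w => \1_(h @^-1` [set y]) (X w) * G w).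
  apply: measurable_funM => //.
  have mh : measurable (h @^-1` [set y]) by [].
  exact: (measurableT_comp (measurable_indic mh) mX).
have ge0 y w : (0 <= y%:E * (\1_(h @^-1` [set y]) (X w) * G w)%:E)%E.
  by rewrite EFinM muleA mule_ge0 ?lee_fin//; exact: nnfun_muleindic_ge0.
rewrite ge0_integral_fsum//; last first.
  by move=> y; apply: measurable_funeM; exact/measurable_EFinP.
rewrite integralT_nnsfun sintegralE ge0_mule_fsuml; last first.
  by move=> y; exact: nnsfun_mulemu_ge0.
apply: eq_fsbigr => y; rewrite inE => -[x _ <-].
rewrite ge0_integralZl//.
- by rewrite indicator_case// muleA.
- exact/measurable_EFinP.
- by move=> w _; rewrite lee_fin mulr_ge0// indicE.
- by rewrite lee_fin.
Qed.

(** The usual passage from indicators to simple functions to monotone limits, for one factor only;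
    [k] plays the role of the integral of the other factor [G]. Finiteness of [k] makes
    multiplication by it continuous. *)
Lemma ge0_integral_indep_factor (g : T -> R) : measurable_fun setT g ->
  (forall x, 0 <= g x) ->
  (\int[P]_w (g (X w) * G w)%:E = (\int[rho]_x (g x)%:E) * k)%E.
Proof.
move=> mg g0.
have mg' : measurable_fun setT (EFin \o g) by exact/measurable_EFinP.
pose h := nnsfun_approx measurableT mg'.
have hg x : (h n x)%:E @[n --> \oo] --> (g x)%:E.
  by apply: (@cvg_nnsfun_approx _ _ _ _ measurableT _ mg') => // y _; rewrite lee_fin.
have c1 : (\int[P]_w (h n (X w) * G w)%:E @[n --> \oo] --> \int[P]_w (g (X w) * G w)%:E)%E.
  rewrite (_ : (\int[P]_w (g (X w) * G w)%:E)%E =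
      (\int[P]_w limn (fun n => (h n (X w) * G w)%:E))%E); last first.
    apply: eq_integral => w _; apply/esym/cvg_lim => //.
    under eq_fun do rewrite EFinM; rewrite EFinM.
    by apply: cvgeZr => //; exact: hg.
  apply: cvg_monotone_convergence => //.
  - move=> n; apply/measurable_EFinP/measurable_funM => //.
    exact: measurableT_comp.
  - by move=> n w _; rewrite lee_fin mulr_ge0.
  - move=> w _ n m nm; rewrite lee_fin ler_wpM2r//.
    by have /lefP := nd_nnsfun_approx measurableT mg' nm; exact.
have c2 : (\int[rho]_x (h n x)%:E @[n --> \oo] --> \int[rho]_x (g x)%:E)%E.
  rewrite (_ : (\int[rho]_x (g x)%:E)%E = (\int[rho]_x limn (fun n => (h n x)%:E))%E); last first.
    by apply: eq_integral => x _; apply/esym/cvg_lim.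
  apply: cvg_monotone_convergence => //.
  - by move=> n; exact/measurable_EFinP.
  - by move=> n x _; rewrite lee_fin.
  - move=> x _ n m nm; rewrite lee_fin.
    by have /lefP := nd_nnsfun_approx measurableT mg' nm; exact.
have c3 := cvgeZr kfin c2.
have ee : (fun n => \int[P]_w (h n (X w) * G w)%:E)%E = (fun n => (\int[rho]_x (h n x)%:E) * k)%E.
  by apply/funext => n; exact: simple_case.
rewrite ee in c1.
by move/cvg_lim : (c1) => <-//; move/cvg_lim : (c3) => <-.
Qed.

End independent_factor.

Section product_measure.
Context {R : realType} {disp} {T : measurableType disp} (rho : probability T R).
Context (J : choiceType) (P : probability (powT J T) R).
Hypothesis hP : is_product_measure rho P.

Lemma measurable_coord (j : J) :
  measurable_fun setT ((fun x => x j) : powT J T -> T).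
Proof.
move=> _ A mA; apply: sub_gen_smallest; exists j => //.
by exists A.
Qed.

Lemma measurable_prod_coord (F : seq J) (g : J -> T -> R) :
  (forall j, measurable_fun setT (g j)) ->
  measurable_fun setT ((fun x => \prod_(j <- F) g j (x j)) : powT J T -> R).
Proof.
move=> mg; apply: measurable_prod => j _.
by apply: (measurableT_comp (mg j)); exact: measurable_coord.
Qed.

(* The factors are generalized from indicator functions one coordinate at a time. *)
Lemma ge0_integral_prod_coord (F : {fset J}) (g : J -> T -> R) :
  (forall j, measurable_fun setT (g j)) -> (forall j x, 0 <= g j x) ->
  (forall j, rho.-integrable setT (EFin \o g j)) ->
  (\int[P]_x (\prod_(j <- F) g j (x j))%:E = \prod_(j <- F) \int[rho]_y (g j y)%:E)%E.
Proof.
move=> mg g0 ig.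
suff : forall (l : seq J) (g : J -> T -> R), (forall j, measurable_fun setT (g j)) -> (forall j x, 0 <= g j x) ->
  (forall j, rho.-integrable setT (EFin \o g j)) ->
  (forall j, j \notin l -> exists2 A, measurable A & g j = \1_A) ->
  (\int[P]_x (\prod_(j <- F) g j (x j))%:E = \prod_(j <- F) \int[rho]_y (g j y)%:E)%E.
  (* Factors outside [F] do not occur in the product; they are replaced by 1, the indicator of the
     whole space, so that the induction can start from the list of [F]. *)
  move=> /(_ (enum_fset F) (fun j => if j \in F then g j else cst 1)).
  rewrite (_ : (\prod_(j <- F) \int[rho]_y ((if j \in F then g j else cst 1) y)%:E)%E =
               (\prod_(j <- F) \int[rho]_y (g j y)%:E)%E); last first.
    by rewrite big_seq [RHS]big_seq; apply: eq_bigr => j jF; rewrite jF.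
  rewrite (_ : (\int[P]_x (\prod_(j <- F) (if j \in F then g j else cst 1) (x j))%:E)%E =
               (\int[P]_x (\prod_(j <- F) g j (x j))%:E)%E); last first.
    by apply: eq_integral => x _; rewrite big_seq [in RHS]big_seq; congr (_%:E);
       apply: eq_bigr => j jF; rewrite jF.
  apply.
  - by move=> j; case: ifP.
  - by move=> j x; case: ifP.
  - by move=> j; case: ifP => // _; exact: (finite_measure_integrable_cst rho 1 measurableT).
  - by move=> j; rewrite -[_ \in enum_fset _]/(j \in F) => /negbTE ->; exists setT => //; rewrite indicT.
elim => [{mg g0 ig}g mg g0 ig hl|i l ih {mg g0 ig}g mg g0 ig hl].
  have /choice[A hA] : forall j, exists A, measurable A /\ g j = \1_A.
    by move=> j; have [A mA gA] := hl j isT; exists A.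
  have mA j : measurable (A j) by have [] := hA j.
  have gA j : g j = \1_(A j) by have [] := hA j.
  have -> : (\prod_(j <- F) \int[rho]_y (g j y)%:E = \prod_(j <- F) rho (A j))%E.
    by apply: eq_bigr => j _; rewrite gA integral_indic// setIT.
  rewrite -hP//.
  pose B := [set x : J -> T | forall j, j \in F -> A j (x j)].
  have mB : measurable (B : set (powT J T)).
    rewrite (_ : B = \bigcap_(j in [set` F]) ((fun x : powT J T => x j) @^-1` A j)); last first.
      by apply/seteqP; split.
    apply: fin_bigcap_measurable => // j _.
    by rewrite -[X in measurable X]setTI; exact: measurable_coord.
  transitivity (\int[P]_x (\1_B x)%:E)%E; last by rewrite integral_indic// setIT.
  apply: eq_integral => x _; congr (_%:E).
  rewrite indicE; case: (boolP (x \in B)); rewrite ?inE ?notin_setE => Bx.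
    by rewrite big_seq big1// => j jF; rewrite gA indicE mem_set//; exact: Bx.
  have /existsNP[j /not_implyP[jF nA]] := Bx.
  by rewrite (big_fsetD1 j)//= gA indicE memNset// mul0r.
have [iF|iF] := boolP (i \in F); last first.
  have := ih (fun j => if j == i then cst 1 else g j).
  rewrite (_ : (\prod_(j <- F) \int[rho]_y ((if j == i then cst 1 else g j) y)%:E)%E =
               (\prod_(j <- F) \int[rho]_y (g j y)%:E)%E); last first.
    rewrite big_seq [RHS]big_seq; apply: eq_bigr => j jF.
    by case: eqP => // ji; rewrite -ji jF in iF.
  rewrite (_ : (\int[P]_x (\prod_(j <- F) (if j == i then cst 1 else g j) (x j))%:E)%E =
               (\int[P]_x (\prod_(j <- F) g j (x j))%:E)%E); last first.
    apply: eq_integral => x _; rewrite big_seq [in RHS]big_seq; congr (_%:E).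
    by apply: eq_bigr => j jF; case: eqP => // ji; rewrite -ji jF in iF.
  apply.
  - by move=> j; case: ifP.
  - by move=> j x; case: ifP.
  - by move=> j; case: ifP => // _; exact: (finite_measure_integrable_cst rho 1 measurableT).
  - move=> j jl; case: eqP => [_|/eqP ji]; first by exists setT => //; rewrite indicT.
    by apply: hl; rewrite inE negb_or ji.
rewrite (big_fsetD1 i)//=.
under eq_integral do rewrite (big_fsetD1 i)//=.
apply: (ge0_integral_indep_factor (X := fun x : powT J T => x i)).
- exact: measurable_coord.
- exact: measurable_prod_coord.
- by move=> x; exact: prodr_ge0.
- by apply: prode_fin_num => j _; exact: (integrable_fin_num measurableT (ig j)).
- move=> A mA.
  (* With the factor at [i] replaced by an indicator, the induction hypothesis is exactly the
     indicator case from which that factor is freed. *)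
  have := ih (fun j => if j == i then \1_A else g j).
  rewrite (big_fsetD1 i)//= eqxx integral_indic// setIT.
  rewrite (_ : (\prod_(j <- (F `\ i)%fset) \int[rho]_y ((if j == i then \1_A else g j) y)%:E)%E =
               (\prod_(j <- (F `\ i)%fset) \int[rho]_y (g j y)%:E)%E); last first.
    rewrite big_seq [RHS]big_seq; apply: eq_bigr => j.
    by rewrite !inE => /andP[/negbTE ->].
  rewrite (_ : (\int[P]_x (\prod_(j <- F) (if j == i then \1_A else g j) (x j))%:E)%E =
               (\int[P]_x (\1_A (x i) * \prod_(j <- (F `\ i)%fset) g j (x j))%:E)%E); last first.
    apply: eq_integral => x _; rewrite (big_fsetD1 i)//= eqxx; congr ((_ * _)%:E).
    rewrite big_seq [in RHS]big_seq; apply: eq_bigr => j.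
    by rewrite !inE => /andP[/negbTE ->].
  apply.
  + by move=> j; case: ifP => // _; exact: measurable_indic.
  + by move=> j x; case: ifP => // _; rewrite indicE.
  + by move=> j; case: ifP => // _; exact: (integrable_indic rho mA).
  + move=> j jl; case: eqP => [_|/eqP ji]; first by exists A.
    by apply: hl; rewrite inE negb_or ji.
- exact: mg.
- exact: g0.
Qed.

Lemma integrable_prod_coord (F : {fset J}) (g : J -> T -> R) :
  (forall j, rho.-integrable setT (EFin \o g j)) ->
  P.-integrable setT (EFin \o (fun x : powT J T => \prod_(j <- F) g j (x j))).
Proof.
move=> ig.
have mg j : measurable_fun setT (g j) by apply/measurable_EFinP; exact: (measurable_int rho (ig j)).
apply/integrableP; split; first by apply/measurable_EFinP; exact: measurable_prod_coord.
under eq_integral do rewrite /= normr_prod.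
rewrite (@ge0_integral_prod_coord F (fun j => Num.norm \o g j)).
- rewrite ltey_eq prode_fin_num// => j _.
  exact: (integrable_fin_num measurableT (integrable_norm (ig j))).
- by move=> j; exact: measurableT_comp.
- by move=> j x /=.
- by move=> j; exact: (integrable_norm (ig j)).
Qed.

(** Sections of K may change sign. The list [l] contains the coordinates whose factor has unknown
    sign; splitting one such factor into positive and negative parts shortens the list, and the
    nonnegative case ends the induction. *)
Lemma Rintegral_prod_coord (F : {fset J}) (g : J -> T -> R) :
  (forall j, rho.-integrable setT (EFin \o g j)) ->
  \int[P]_x \prod_(j <- F) g j (x j) = \prod_(j <- F) \int[rho]_y g j y.
Proof.
move=> ig.
suff : forall (l : seq J) (g : J -> T -> R),
  (forall j, rho.-integrable setT (EFin \o g j)) ->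
  (forall j, j \in F -> j \notin l -> forall x, 0 <= g j x) ->
  \int[P]_x \prod_(j <- F) g j (x j) = \prod_(j <- F) \int[rho]_y g j y.
  by move=> h; apply: (h (enum_fset F)) => // j jF; rewrite -[_ \in enum_fset _]/(j \in F) jF.
elim => [{ig}g ig hl|i l ih {ig}g ig hl].
  pose g' j x := if j \in F then g j x else 1.
  transitivity (\int[P]_x \prod_(j <- F) g' j (x j)).
    by apply: eq_Rintegral => x _; rewrite big_seq [RHS]big_seq; apply: eq_bigr => j jF; rewrite /g' jF.
  transitivity (\prod_(j <- F) \int[rho]_y g' j y); last first.
    by rewrite big_seq [RHS]big_seq; apply: eq_bigr => j jF; rewrite /g' jF.
  have ig' j : rho.-integrable setT (EFin \o g' j).
    by rewrite /g'; case: (j \in F); [exact: ig | exact: (finite_measure_integrable_cst rho 1 measurableT)].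
  rewrite /Rintegral (@ge0_integral_prod_coord F g')//.
  - rewrite -[RHS]/(fine (_%:E)) -prodEFin; congr fine; apply: eq_bigr => j _.
    by rewrite fineK//; exact: (integrable_fin_num measurableT (ig' j)).
  - by move=> j; apply/measurable_EFinP; exact: (measurable_int rho (ig' j)).
  - by move=> j x; rewrite /g'; case: ifP => // jF; exact: hl.
have [iF|iF] := boolP (i \in F); last first.
  apply: ih => // j jF jl; apply: hl => //; rewrite inE negb_or jl andbT.
  by apply: contraNN iF => /eqP <-.
pose g1 j := if j == i then (g j)^\+ else g j.
pose g2 j := if j == i then (g j)^\- else g j.
have ig1 j : rho.-integrable setT (EFin \o g1 j).
  by rewrite /g1; case: eqP => // _; apply: integrable_funrpos.
have ig2 j : rho.-integrable setT (EFin \o g2 j).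
  by rewrite /g2; case: eqP => // _; apply: integrable_funrneg.
have hl1 j : j \in F -> j \notin l -> forall x, 0 <= g1 j x.
  move=> jF jl x; rewrite /g1; case: eqP => [_|/eqP ji]; first exact: funrpos_ge0.
  by apply: hl => //; rewrite inE negb_or ji.
have hl2 j : j \in F -> j \notin l -> forall x, 0 <= g2 j x.
  move=> jF jl x; rewrite /g2; case: eqP => [_|/eqP ji]; first exact: funrneg_ge0.
  by apply: hl => //; rewrite inE negb_or ji.
have off1 j : j \in (F `\ i)%fset -> g1 j = g j by rewrite !inE /g1 => /andP[/negbTE ->].
have off2 j : j \in (F `\ i)%fset -> g2 j = g j by rewrite !inE /g2 => /andP[/negbTE ->].
have gi : g i = g1 i \- g2 i by rewrite /g1 /g2 eqxx; exact: (esym (funrposBneg (g i))).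
transitivity (\int[P]_x (\prod_(j <- F) g1 j (x j) - \prod_(j <- F) g2 j (x j))).
  apply: eq_Rintegral => x _; rewrite !(big_fsetD1 i iF)/=.
  rewrite (eq_big_seq (fun j => g j (x j)) (fun j jF => congr1 (fun h => h (x j)) (off1 j jF))).
  rewrite (eq_big_seq (fun j => g j (x j)) (fun j jF => congr1 (fun h => h (x j)) (off2 j jF))).
  by rewrite gi mulrBl.
rewrite RintegralB//; [|exact: integrable_prod_coord|exact: integrable_prod_coord].
rewrite (ih g1)// (ih g2)// !(big_fsetD1 i iF)/= gi.
rewrite (eq_big_seq (fun j => \int[rho]_y g j y) (fun j jF => congr1 (fun h => \int[rho]_y h y) (off1 j jF))).
rewrite (eq_big_seq (fun j => \int[rho]_y g j y) (fun j jF => congr1 (fun h => \int[rho]_y h y) (off2 j jF))).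
by rewrite RintegralB// mulrBl.
Qed.

End product_measure.

(** * The weighted space *)

Section countable_sum.
Context {R : realType} {I : countType} (A : set I).
Implicit Types F G : I -> R.

(** An exhaustion of [A] by finite lists, read off from the encoding of a countable type. It turns
    unordered sums into limits of sequences, to which monotone and dominated convergence apply. *)
Definition enum_below (N : nat) : seq I :=
  [seq u <- pmap (@pickle_inv I) (iota 0 N) | u \in A].

Lemma enum_below_uniq N : uniq (enum_below N).
Proof. by rewrite filter_uniq// (pmap_uniq (@pickle_invK I))// iota_uniq. Qed.

Lemma enum_below_sub N u : u \in enum_below N -> A u.
Proof. by rewrite mem_filter => /andP[/set_mem]. Qed.

Let term F (k : nat) : R :=
  oapp (fun u => if u \in A then F u else 0) 0 (@pickle_inv I k).

Let sum_enum_below F N : \sum_(u <- enum_below N) F u = \sum_(0 <= k < N) term F k.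
Proof. by rewrite big_filter big_mkcond big_pmap /index_iota subn0. Qed.

Let esum_termE F : (forall u, 0 <= F u) ->
  \esum_(u in A) (F u)%:E = (\sum_(0 <= k <oo) (term F k)%:E)%E.
Proof.
move=> F0; have t0 k : (0 <= (term F k)%:E)%E.
  by rewrite lee_fin /term; case: pickle_inv => //= u; case: ifP.
rewrite nneseries_esumT//.
rewrite (_ : \esum_(i in [set: nat]) _ = \esum_(i in range (@choice.pickle I)) (term F i)%:E); last first.
  rewrite [RHS]esum_mkcond; apply: eq_esum => k _; case: ifPn => //.
  rewrite notin_setE /= /term; case E : pickle_inv => [u|//] h; exfalso; apply: h; exists u => //.
  by have := @pickle_invK I k; rewrite E.
rewrite (reindex_esum [set: I] _ (@choice.pickle I)); last first.
  by split => // u v _ _; exact: (pcan_inj pickleK_inv).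
by rewrite esum_mkcond; apply: eq_esum => u _; rewrite /term pickleK_inv/=; case: ifP.
Qed.

Lemma sum_le_esum F (s : seq I) : (forall u, 0 <= F u) -> uniq s ->
  (forall u, u \in s -> A u) -> ((\sum_(u <- s) F u)%:E <= \esum_(u in A) (F u)%:E)%E.
Proof.
move=> F0 us sA; rewrite -sumEFin -[X in (X <= _)%E](_ : (\sum_(u \in [set` s]) (F u)%:E)%E = _).
  by apply: ereal_sup_ubound; exists [set` s] => //; split => //; exact: finite_seq.
by rewrite (fsbig_seq _ _ us).
Qed.

Lemma ge0_cvg_sum_enum_below F : (forall u, 0 <= F u) ->
  ((\sum_(u <- enum_below N) F u)%:E @[N --> \oo] --> \esum_(u in A) (F u)%:E)%E.
Proof.
move=> F0; rewrite esum_termE//.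
under eq_fun do rewrite sum_enum_below -sumEFin.
apply: is_cvg_nneseries => k _ _.
by rewrite lee_fin /term; case: pickle_inv => //= u; case: ifP.
Qed.

Lemma ge0_cvg_sum_enum_below_fine F : (forall u, 0 <= F u) ->
  (\esum_(u in A) (F u)%:E < +oo)%E ->
  \sum_(u <- enum_below N) F u @[N --> \oo] --> fine (\esum_(u in A) (F u)%:E)%E.
Proof.
move=> F0 Foo; have Ffin : \esum_(u in A) (F u)%:E \is a fin_num.
  by rewrite ge0_fin_numE// esum_ge0// => u _; rewrite lee_fin.
by have := ge0_cvg_sum_enum_below F0; rewrite -{1}(fineK Ffin) => /fine_cvg.
Qed.

Lemma cvg_sum_enum_below F G : (forall u, A u -> `|F u| <= G u) ->
  (\esum_(u in A) (G u)%:E < +oo)%E ->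
  \sum_(u <- enum_below N) F u @[N --> \oo] --> real_esum A F.
Proof.
move=> FG Goo.
have fin H : (forall u, 0 <= H u) -> (forall u, A u -> H u <= G u) ->
    (\esum_(u in A) (H u)%:E < +oo)%E.
  move=> H0 HG; apply: le_lt_trans Goo; apply: le_esum => u Au; rewrite lee_fin; exact: HG.
rewrite /real_esum.
have -> : (fun N => \sum_(u <- enum_below N) F u) = (fun N =>
    \sum_(u <- enum_below N) Num.max (F u) 0 - \sum_(u <- enum_below N) Num.max (- F u) 0).
  apply/funext => N; rewrite -sumrB; apply: eq_bigr => u _.
  rewrite /Num.max; case: ltP => h1; case: ltP => h2; lra.
apply: cvgB; apply: ge0_cvg_sum_enum_below_fine.
- by move=> u; rewrite le_max lexx orbT.
- apply: fin => u; first by rewrite le_max lexx orbT.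
  by move=> Au; rewrite ge_max (le_trans (ler_norm _) (FG _ Au)) (le_trans (normr_ge0 _) (FG _ Au)).
- by move=> u; rewrite le_max lexx orbT.
- apply: fin => u; first by rewrite le_max lexx orbT.
  move=> Au; rewrite ge_max (le_trans _ (FG _ Au)) ?(le_trans (normr_ge0 _) (FG _ Au))//.
  by rewrite -normrN ler_norm.
Qed.

Lemma nondecreasing_sum_enum_below F : (forall u, 0 <= F u) ->
  {homo (fun N => \sum_(u <- enum_below N) F u) : m n / (m <= n)%N >-> m <= n}.
Proof.
move=> F0 m n mn /=; rewrite !sum_enum_below (big_cat_nat (leq0n m) mn)/= lerDl.
by apply: sumr_ge0 => k _; rewrite /term; case: pickle_inv => //= u; case: ifP.
Qed.

End countable_sum.

Lemma integrable_Rsum {R : realType} {disp} {Om : measurableType disp}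
    (P : {measure set Om -> \bar R}) (X : set Om) (I : eqType) (s : seq I) (f : I -> Om -> R) :
  measurable X -> (forall i, i \in s -> P.-integrable X (EFin \o f i)) ->
  P.-integrable X (EFin \o (fun w => \sum_(i <- s) f i w)).
Proof.
move=> mX; elim: s => [|i s ih] hf.
  apply: (eq_integrable mX (cst 0%E)); last exact: integrable0.
  by move=> w _; rewrite /= big_nil.
apply: (eq_integrable mX (fun w => (f i w)%:E + (\sum_(j <- s) f j w)%R%:E)%E).
  by move=> w _; rewrite /= big_cons EFinD.
apply: integrableD => //; first by apply: hf; rewrite mem_head.
by apply: ih => j js; apply: hf; rewrite inE js orbT.
Qed.

Lemma Rintegral_sum {R : realType} {disp} {Om : measurableType disp}
    (P : {measure set Om -> \bar R}) (X : set Om) (I : eqType) (s : seq I) (f : I -> Om -> R) :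
  measurable X -> (forall i, i \in s -> P.-integrable X (EFin \o f i)) ->
  \int[P]_(w in X) (\sum_(i <- s) f i w) = \sum_(i <- s) \int[P]_(w in X) f i w.
Proof.
move=> mX; elim: s => [|i s ih] hf.
  under eq_Rintegral do rewrite big_nil.
  by rewrite Rintegral_cst// mul0r big_nil.
under eq_Rintegral do rewrite big_cons.
rewrite RintegralD//.
- by rewrite big_cons ih// => j js; apply: hf; rewrite inE js orbT.
- by apply: hf; rewrite mem_head.
- by apply: integrable_Rsum => // j js; apply: hf; rewrite inE js orbT.
Qed.

(** * The kernel K, its mean embedding and products over coordinates *)

Section kernel_facts.
Context {R : realType} {D : set R} (c : D) (K : dom c -> dom c -> R).
Context (rho : probability (dom c) R).
Hypothesis HU : forall u : {fset nat}, rkhs (prodK K u).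
Hypothesis hKmeas : measurable_fun setT (fun z : dom c * dom c => K z.1 z.2).
Hypothesis Ksym : forall a b, K a b = K b a.
Hypothesis hKc : K c c = 0.
Hypothesis hM : (\int[rho]_a (K a a)%:E < +oo)%E.

(** Through constant sequences, the space of the single coordinate 0 transfers the general kernel
    inequalities to K itself. *)
Lemma prodK_fset1 (j : nat) (x y : nat -> dom c) : prodK K [fset j]%fset x y = K (x j) (y j).
Proof. by rewrite /prodK big_seq_fset1. Qed.

Lemma K_diag_ge0 a : 0 <= K a a.
Proof. by rewrite -(prodK_fset1 0%N (fun=> a) (fun=> a)) (kernel_diag_ge0 (HU [fset 0%N]%fset)). Qed.

Lemma K_le a b : `|K a b| <= 2^-1 * (K a a + K b b).
Proof.
have := rkhs_kernel_le (HU [fset 0%N]%fset) (fun=> a) (fun=> b).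
by rewrite !prodK_fset1.
Qed.

(** The section at [b], evaluated at [c], is bounded by a multiple of the square root of K(c, c) =
    0. This vanishing makes truncation of a point act on each component by a factor 0 or 1. *)
Lemma K_anchor b : K c b = 0.
Proof.
have Vs := rkhs_section (HU [fset 0%N]%fset) (fun=> b).
have := rkhs_eval_le (fun=> c) Vs.
by rewrite !prodK_fset1 hKc sqrtr0 mulr0 normr_le0 => /eqP.
Qed.

Lemma measurable_K_section b : measurable_fun setT (fun a => K a b).
Proof.
exact: (measurableT_comp hKmeas (measurable_fun_pair (measurable_id (D := setT)) (measurable_cst b))).
Qed.

Lemma measurable_K_diag : measurable_fun setT (fun a => K a a).
Proof.
exact: (measurableT_comp hKmeas (measurable_fun_pair (measurable_id (D := setT)) (measurable_id (D := setT)))).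
Qed.

Lemma integrable_K_diag : rho.-integrable setT (EFin \o (fun a => K a a)).
Proof.
apply/integrableP; split; first by apply/measurable_EFinP; exact: measurable_K_diag.
by under eq_integral do rewrite /= ger0_norm ?K_diag_ge0//.
Qed.

Lemma integrable_K_section b : rho.-integrable setT (EFin \o (fun a => K a b)).
Proof.
apply: (@le_integrable _ _ _ _ _ measurableT _ (fun a => (2^-1)%:E * ((K a a)%:E + (K b b)%:E))%E).
- by apply/measurable_EFinP; exact: measurable_K_section.
- by move=> a _; rewrite -EFinD -EFinM lee_fin; apply: le_trans (K_le a b) _; exact: ler_norm.
apply: integrableZl => //; apply: integrableD => //; first exact: integrable_K_diag.
exact: (finite_measure_integrable_cst rho (K b b) measurableT).
Qed.

(** The kernel mean embedding of [rho]: the representer of integration. *)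
Definition kmean (b : dom c) : R := \int[rho]_a K a b.

(** No interchange of integrals is needed: [kmean] represents the error functional without nodes, so
    it belongs to a space all of whose members are integrable. *)
Lemma integrable_kmean : rho.-integrable setT (EFin \o kmean).
Proof.
pose H1 := HU [fset 0%N]%fset.
pose tau (a : dom c) : nat -> dom c := fun=> a.
have msec y : measurable_fun setT (fun w => prodK K [fset 0%N]%fset (tau w) y).
  by under eq_fun do rewrite prodK_fset1; exact: measurable_K_section.
have idiag : rho.-integrable setT (fun w => (prodK K [fset 0%N]%fset (tau w) (tau w))%:E).
  by under eq_fun do rewrite prodK_fset1; exact: integrable_K_diag.
have [h [Vh _ hE _]] := quad_error_representer H1 measurableT msec idiag [::].
apply: (eq_integrable measurableT (EFin \o (h \o tau))); last exact: (rkhs_integrable measurableT msec idiag Vh).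
move=> b _ /=; rewrite hE /quad_error big_nil subr0; congr (_%:E).
by apply: eq_Rintegral => a _; rewrite prodK_fset1.
Qed.

Lemma Rintegral_kmean : \int[rho]_b kmean b = double_mean K rho.
Proof.
by apply: eq_Rintegral => b _; apply: eq_Rintegral => a _; exact: Ksym.
Qed.

Definition prod_kmean (u : {fset nat}) (y : nat -> dom c) : R := \prod_(j <- u) kmean (y j).

(* The value of [quad_error] applied to both variables of [prodK K u]. It does not
   depend on the underlying product space, so that errors on D^[d] can be
   transported to D^N. *)
Definition sq_error (u : {fset nat}) (r : seq (R * (nat -> dom c))) : R :=
  double_mean K rho ^+ #|` u|%fset - 2 * (\sum_(p <- r) p.1 * prod_kmean u p.2)
  + \sum_(p <- r) p.1 * \sum_(q <- r) q.1 * prodK K u q.2 p.2.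

Lemma prodK_sym u x y : prodK K u x y = prodK K u y x.
Proof. by apply: eq_bigr => j _; exact: Ksym. Qed.

(** The sample space stays abstract because the formula is used twice: on D^w, where the quadrature
    bounds are assumed, and on the weighted domain, where the algorithm is analysed. *)
Lemma quad_error_prodK {disp} {Om : measurableType disp} (P : probability Om R)
    (X : set Om) (tau : Om -> nat -> dom c) (u : {fset nat}) r :
  measurable X ->
  (forall y, P.-integrable X (EFin \o (fun w => prodK K u (tau w) y))) ->
  (forall y, \int[P]_(w in X) prodK K u (tau w) y = prod_kmean u y) ->
  P.-integrable X (EFin \o (fun w => prod_kmean u (tau w))) ->
  \int[P]_(w in X) prod_kmean u (tau w) = double_mean K rho ^+ #|` u|%fset ->
  quad_error P X tau r (fun y => quad_error P X tau r (prodK K u ^~ y)) = sq_error u r.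
Proof.
move=> mX iK eK im em.
have qE y : quad_error P X tau r (prodK K u ^~ y) =
    prod_kmean u y - \sum_(p <- r) p.1 * prodK K u p.2 y.
  by rewrite /quad_error eK.
rewrite (_ : (fun y => _) = fun y => prod_kmean u y - \sum_(p <- r) p.1 * prodK K u p.2 y);
  last exact/funext.
have iKr (p : R * (nat -> dom c)) : P.-integrable X (EFin \o (fun w => p.1 * prodK K u p.2 (tau w))).
  have := integrableZl mX p.1 (iK p.2); apply: eq_integrable => // w _.
  by rewrite /= prodK_sym.
rewrite /quad_error RintegralB//; last by apply: integrable_Rsum.
rewrite em Rintegral_sum// /sq_error.
rewrite (eq_bigr (fun p => p.1 * prod_kmean u p.2)); last first.
  move=> p _; rewrite RintegralZl//; last first.
    by have := iK p.2; apply: eq_integrable => // w _; rewrite /= prodK_sym.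
  by congr (_ * _); rewrite -eK; apply: eq_Rintegral => w _; exact: prodK_sym.
rewrite [X in _ - _ - X](eq_bigr (fun p => p.1 * prod_kmean u p.2 -
    p.1 * \sum_(q <- r) q.1 * prodK K u q.2 p.2)); last by move=> p _; rewrite mulrBr.
rewrite sumrB; ring.
Qed.

Section product_space.
Context (J : choiceType) (P : probability (powT J (dom c)) R).
Hypothesis hP : is_product_measure rho P.

Lemma Rintegral_prod_section (F : {fset J}) (y : J -> dom c) :
  \int[P]_x \prod_(j <- F) K (x j) (y j) = \prod_(j <- F) kmean (y j).
Proof. by rewrite (Rintegral_prod_coord hP F (fun j => integrable_K_section (y j))). Qed.

Lemma Rintegral_prod_kmean (F : {fset J}) :
  \int[P]_x \prod_(j <- F) kmean (x j) = double_mean K rho ^+ #|` F|%fset.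
Proof.
rewrite (Rintegral_prod_coord hP F (fun j => integrable_kmean)) Rintegral_kmean.
by rewrite big_const_seq count_predT iter_mulr_1.
Qed.

End product_space.
End kernel_facts.

Section anchored_points.
Context {R : realType} {D : set R} (c : D).

Lemma anchored_in (u : {fset nat}) (t : u -> dom c) (j : u) : anchored t (val j) = t j.
Proof. by rewrite /anchored valK. Qed.

Lemma anchored_out (u : {fset nat}) (t : u -> dom c) j : j \notin u -> anchored t j = c.
Proof. by move=> ju; rewrite /anchored insubN. Qed.

Lemma anchored_fincl (u v : {fset nat}) (t : v -> dom c) (uv : (u `<=` v)%fset) j :
  j \in u -> anchored (t \o fincl uv) j = anchored t j.
Proof.
move=> ju; pose i : u := [` ju]%fset.
by rewrite -[j]/(val i) anchored_in [RHS](anchored_in t (fincl uv i)).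
Qed.

End anchored_points.

(** The product measure on D^u is indexed by u viewed as a type, whereas [prodK] runs over the
    natural numbers in u; this passes from one to the other. *)
Lemma big_fset_finType (R : Type) (idx : R) (op : Monoid.com_law idx)
    (I : choiceType) (X : {fset I}) (F : I -> R) :
  \big[op/idx]_(j <- X) F j = \big[op/idx]_(j <- [fset j in {: X}]%fset) F (val j).
Proof.
rewrite big_seq_fsetE /=; apply: perm_big; apply: uniq_perm.
- exact: index_enum_uniq.
- exact: fset_uniq.
- by move=> j; rewrite mem_index_enum !inE.
Qed.

(** * Transport of the assumed quadrature bounds *)

Section quadrature_error.
Context {R : realType} {D : set R} (c : D) (K : dom c -> dom c -> R).
Context (rho : probability (dom c) R).
Hypothesis HU : forall u : {fset nat}, rkhs (prodK K u).
Hypothesis hKmeas : measurable_fun setT (fun z : dom c * dom c => K z.1 z.2).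
Hypothesis Ksym : forall a b, K a b = K b a.
Hypothesis hM : (\int[rho]_a (K a a)%:E < +oo)%E.

(** The worst-case bound refers to the product measure on D^w; the conclusion no longer does, so it
    can be carried to any other set of coordinates. *)
Lemma sq_error_quad_u d n (a : 'I_n -> R) (t : 'I_n -> upto d -> dom c)
    (w : {fset nat}) (wd : (w `<=` upto d)%fset) (rhow : probability (powT w (dom c)) R) (B : R) :
  is_product_measure rho rhow -> 0 <= B ->
  (worst_case_error (HU w) (integral_u rhow) (quad_u a t wd) <= B%:E)%E ->
  sq_error K rho w [seq (a i, anchored (t i \o fincl wd)) | i <- enum 'I_n] <= B ^+ 2.
Proof.
move=> hP B0 le.
pose F := [fset j in {: w}]%fset.
have prodE (g : nat -> dom c -> R) (x : powT w (dom c)) :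
    \prod_(j <- w) g j (anchored x j) = \prod_(j <- F) g (val j) (x j).
  by rewrite big_fset_finType; apply: eq_bigr => j _; rewrite anchored_in.
have cardF : #|` F|%fset = #|` w|%fset by rewrite -!sum1_size [RHS]big_fset_finType.
have iK y : rhow.-integrable setT (EFin \o (fun x : powT w (dom c) => prodK K w (anchored x) y)).
  have := integrable_prod_coord hP F (fun j => integrable_K_section HU hKmeas hM (y (val j))).
  apply: eq_integrable => // x _; rewrite /prodK /=; congr (_%:E).
  by rewrite -(prodE (fun j a => K a (y j))).
have r := worst_case_error_ge (H := HU w) measurableT _ _ _ B0 le.
rewrite -(quad_error_prodK (tau := fun x : powT w (dom c) => anchored x) Ksym _ measurableT iK).
- apply: r.
  + by move=> y; apply/measurable_EFinP; exact: (measurable_int rhow (iK y)).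
  + have := integrable_prod_coord hP F (fun j => integrable_K_diag HU hKmeas hM).
    apply: eq_integrable => // x _; rewrite /prodK /=; congr (_%:E).
    by rewrite -(prodE (fun j a => K a a)).
  + by move=> f Vf; rewrite /quad_error /integral_u /quad_u big_map big_enum.
- move=> y; rewrite /prod_kmean big_fset_finType -(Rintegral_prod_section HU hKmeas hM hP).
  by apply: eq_Rintegral => x _; rewrite /prodK (prodE (fun j a => K a (y j))).
- have := integrable_prod_coord hP F (fun j => integrable_kmean HU hKmeas hM).
  apply: eq_integrable => // x _; rewrite /= /prod_kmean; congr (_%:E).
  by rewrite -(prodE (fun j a => kmean K rho a)).
- rewrite -cardF -(Rintegral_prod_kmean HU hKmeas Ksym hM hP).
  by apply: eq_Rintegral => x _; rewrite /prod_kmean (prodE (fun j a => kmean K rho a)).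
Qed.

(** [sq_error] sees a set of coordinates only through its cardinality and through products of values
    at the nodes, so an injective relabelling leaves it unchanged. The points z' matter only on
    [u]. *)
Lemma sq_error_reindex (u : {fset nat}) (phi : nat -> nat) n (a : 'I_n -> R)
    (z z' : 'I_n -> nat -> dom c) :
  {in u &, injective phi} ->
  (forall i j, j \in u -> z' i j = z i (phi j)) ->
  sq_error K rho u [seq (a i, z' i) | i <- enum 'I_n] =
  sq_error K rho (phi @` u)%fset [seq (a i, z i) | i <- enum 'I_n].
Proof.
move=> inj zz'; rewrite /sq_error card_in_imfset//= !big_map.
rewrite [in RHS](eq_bigr (fun i => a i * prod_kmean K rho u (z' i))); last first.
  move=> i _; congr (_ * _); rewrite /prod_kmean big_imfset//=.
  by rewrite big_seq [RHS]big_seq; apply: eq_bigr => j ju; rewrite zz'.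
congr (_ + _); apply: eq_bigr => i _; congr (_ * _); rewrite !big_map.
apply: eq_bigr => i' _; congr (_ * _); rewrite /prodK big_imfset//=.
by rewrite big_seq [RHS]big_seq; apply: eq_bigr => j ju; rewrite !zz'.
Qed.

End quadrature_error.

(** * The weighted domain has full measure *)

Section weighted.
Context {R : realType} {D : set R} (c : D) (K : dom c -> dom c -> R).
Context (rho : probability (dom c) R) (mu : probability (powT nat (dom c)) R).
Context (gamma : {fset nat} -> R).
Hypothesis HU : forall u : {fset nat}, rkhs (prodK K u).
Hypothesis hKmeas : measurable_fun setT (fun z : dom c * dom c => K z.1 z.2).
Hypothesis Ksym : forall a b, K a b = K b a.
Hypothesis hKc : K c c = 0.
Hypothesis hM : (\int[rho]_a (K a a)%:E < +oo)%E.
Hypothesis hmu : is_product_measure rho mu.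
Hypothesis hgamma0 : forall u, 0 <= gamma u.
Hypothesis hgammaM :
  (\esum_(u in setT) (gamma u * diag_mean K rho ^+ #|` u|%fset)%:E < +oo)%E.

Local Notation X := (weighted_domain K gamma).
Local Notation act := (enum_below (active gamma)).
Implicit Types (x y : nat -> dom c) (u v : {fset nat}).

Lemma prodK_diag_ge0 u x : 0 <= prodK K u x x.
Proof. exact: (kernel_diag_ge0 (HU u)). Qed.

Lemma weighted_diag_ge0 u x : 0 <= gamma u * prodK K u x x.
Proof. by rewrite mulr_ge0// prodK_diag_ge0. Qed.

Lemma weighted_prodK_le u x y : `|gamma u * prodK K u x y| <=
  2^-1 * (gamma u * prodK K u x x + gamma u * prodK K u y y).
Proof.
rewrite normrM ger0_norm// -mulrDr mulrCA ler_wpM2l//.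
exact: (rkhs_kernel_le (HU u)).
Qed.

Lemma prodK_eq0 u x y : (exists2 j, j \in u & x j = c) -> prodK K u x y = 0.
Proof. by move=> [j ju xj]; rewrite /prodK (big_fsetD1 j)//= xj (K_anchor HU hKc) mul0r. Qed.

Lemma weighted_domain_finite_support v x : (forall j, j \notin v -> x j = c) -> X x.
Proof.
move=> xc; rewrite /weighted_domain /=.
apply: (@le_lt_trans _ _ (\esum_(u in [set` fpowerset v]) (gamma u * prodK K u x x)%:E)%E).
  rewrite (esum_mkcond (active gamma)) (esum_mkcond [set` fpowerset v]); apply: le_esum => u _.
  case: ifPn => [_|_]; last by case: ifP => // _; rewrite lee_fin weighted_diag_ge0.
  case: ifPn => //; rewrite notin_setE /= fpowersetE => /negP uv.
  rewrite prodK_eq0 ?mulr0//.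
  by have /fsubsetPn[j ju jv] := uv; exists j => //; exact: xc.
rewrite esum_fset//=.
- by rewrite fsbig_finite//= sumEFin ltey.
- by move=> u _; rewrite lee_fin weighted_diag_ge0.
Qed.

Let E x : \bar R := (\esum_(u in active gamma) (gamma u * prodK K u x x)%:E)%E.

Let cvgE x : ((\sum_(u <- act N) gamma u * prodK K u x x)%:E @[N --> \oo] --> E x)%E.
Proof. by apply: ge0_cvg_sum_enum_below => u; exact: weighted_diag_ge0. Qed.

Lemma integrable_prodK u y :
  mu.-integrable setT (EFin \o ((fun x => prodK K u x y) : powT nat (dom c) -> R)).
Proof. exact: (integrable_prod_coord hmu u (fun j => integrable_K_section HU hKmeas hM (y j))). Qed.

Lemma integrable_prodK_diag u :
  mu.-integrable setT (EFin \o ((fun x => prodK K u x x) : powT nat (dom c) -> R)).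
Proof. exact: (integrable_prod_coord hmu u (fun j => integrable_K_diag HU hKmeas hM)). Qed.

Lemma integrable_prod_kmean u :
  mu.-integrable setT (EFin \o (prod_kmean K rho u : powT nat (dom c) -> R)).
Proof. exact: (integrable_prod_coord hmu u (fun j => integrable_kmean HU hKmeas hM)). Qed.

Lemma Rintegral_prodK u y : \int[mu]_x prodK K u x y = prod_kmean K rho u y.
Proof. exact: (Rintegral_prod_section HU hKmeas hM hmu). Qed.

Lemma Rintegral_prodK_diag u : \int[mu]_x prodK K u x x = diag_mean K rho ^+ #|` u|%fset.
Proof.
rewrite (Rintegral_prod_coord hmu u (fun j => integrable_K_diag HU hKmeas hM)).
by rewrite big_const_seq count_predT iter_mulr_1.
Qed.

Let mterm N : measurable_fun setT
  ((fun x => \sum_(u <- act N) gamma u * prodK K u x x) : powT nat (dom c) -> R).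
Proof.
apply: measurable_sum => u; apply: measurable_funM; first exact: measurable_cst.
by apply/measurable_EFinP; exact: (measurable_int mu (integrable_prodK_diag u)).
Qed.

Let mE : measurable_fun setT (E : powT nat (dom c) -> \bar R).
Proof.
apply: (emeasurable_fun_cvg (fun N (x : powT nat (dom c)) =>
  (\sum_(u <- act N) gamma u * prodK K u x x)%:E)) => [N|x _]; last exact: cvgE.
by apply/measurable_EFinP; exact: mterm.
Qed.

Lemma measurable_weighted_domain : measurable (X : set (powT nat (dom c))).
Proof.
rewrite (_ : X = setT `&` [set x : powT nat (dom c) | (E x < +oo)%E]); last by rewrite setTI.
exact: emeasurable_fun_infty_o.
Qed.

Lemma sum_weighted_mean_le N : \sum_(u <- act N) gamma u * diag_mean K rho ^+ #|` u|%fset <=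
  fine (\esum_(u in setT) (gamma u * diag_mean K rho ^+ #|` u|%fset)%:E)%E.
Proof.
have g0 u : 0 <= gamma u * diag_mean K rho ^+ #|` u|%fset.
  by rewrite mulr_ge0// exprn_ge0// Rintegral_ge0// => a _; exact: (K_diag_ge0 HU).
rewrite -lee_fin fineK; last by rewrite ge0_fin_numE// esum_ge0// => u _; rewrite lee_fin.
by apply: sum_le_esum => //; exact: enum_below_uniq.
Qed.

(** Monotone convergence along [enum_below]: the diagonal of K_u integrates to M^|u|, so the
    summability of gamma_u M^|u| bounds the integral. Hence almost every point lies in the weighted
    domain. *)
Let intE : (\int[mu]_x E x < +oo)%E.
Proof.
rewrite (_ : (\int[mu]_x E x)%E = (\int[mu]_x limn (fun N =>
    (\sum_(u <- act N) gamma u * prodK K u x x)%:E))%E); last first.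
  by apply: eq_integral => x _; apply/esym/cvg_lim => //; exact: cvgE.
rewrite monotone_convergence//.
- apply: (@le_lt_trans _ _ (fine (\esum_(u in setT) (gamma u * diag_mean K rho ^+ #|` u|%fset)%:E))%:E);
    last by rewrite ltey.
  apply: lime_le.
    apply: ereal_nondecreasing_is_cvgn => m n mn; apply: ge0_le_integral => //.
    - by move=> x _; rewrite lee_fin sumr_ge0// => u _; exact: weighted_diag_ge0.
    - by apply/measurable_EFinP; exact: mterm.
    - by apply/measurable_EFinP; exact: mterm.
    - by move=> x _; rewrite lee_fin; apply: nondecreasing_sum_enum_below => // u; exact: weighted_diag_ge0.
  apply: nearW => N.
  have iu u : mu.-integrable setT (EFin \o ((fun x => gamma u * prodK K u x x) : powT nat (dom c) -> R)).
    exact: (integrableZl measurableT (gamma u) (integrable_prodK_diag u)).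
  rewrite -[X in (X <= _)%E]fineK; last first.
    by apply: (integrable_fin_num measurableT); exact: integrable_Rsum.
  rewrite lee_fin; apply: le_trans (sum_weighted_mean_le N).
  rewrite -/(Rintegral mu setT (fun x : powT nat (dom c) => \sum_(u <- act N) gamma u * prodK K u x x)).
  rewrite Rintegral_sum//; apply: ler_sum => u _.
  by rewrite RintegralZl ?Rintegral_prodK_diag//; exact: integrable_prodK_diag.
- by move=> N; apply/measurable_EFinP; exact: mterm.
- by move=> N x _; rewrite lee_fin sumr_ge0// => u _; exact: weighted_diag_ge0.
- by move=> x _ m n mn; rewrite lee_fin; apply: nondecreasing_sum_enum_below => // u; exact: weighted_diag_ge0.
Qed.

Let iE : mu.-integrable setT (E : powT nat (dom c) -> \bar R).
Proof.
apply/integrableP; split => //; apply: le_lt_trans intE.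
rewrite le_eqVlt; apply/orP; left; apply/eqP; apply: eq_integral => x _.
by rewrite gee0_abs// esum_ge0// => u _; rewrite lee_fin weighted_diag_ge0.
Qed.

Lemma weighted_domain_setC_null : mu (~` (X : set (powT nat (dom c)))) = 0.
Proof.
have [N [mN N0 sub]] := integrable_ae measurableT iE.
apply/eqP; rewrite eq_le measure_ge0 andbT -N0; apply: le_measure.
- by rewrite inE; apply: measurableC; exact: measurable_weighted_domain.
- by rewrite inE.
move=> x nX; apply: sub => /= h; apply: nX; rewrite /weighted_domain /=.
by rewrite -/(E x) ltey_eq (h I).
Qed.

Lemma Rintegral_weighted_domain (f : powT nat (dom c) -> R) :
  mu.-integrable setT (EFin \o f) -> \int[mu]_(x in X) f x = \int[mu]_x f x.
Proof.
move=> iff; rewrite /Rintegral [in RHS](negligible_integral (N := (~` X : set (powT nat (dom c)))))//.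
- by rewrite setTD setCK.
- by apply: measurableC; exact: measurable_weighted_domain.
- exact: weighted_domain_setC_null.
Qed.

Lemma integrable_weighted_domain (f : powT nat (dom c) -> R) :
  mu.-integrable setT (EFin \o f) -> mu.-integrable X (EFin \o f).
Proof. by apply: integrableS => //; exact: measurable_weighted_domain. Qed.

Lemma quad_error_prodK_weighted u r :
  quad_error mu (X : set (powT nat (dom c))) id r (fun y => quad_error mu (X : set (powT nat (dom c))) id r (prodK K u ^~ y)) = sq_error K rho u r.
Proof.
apply: quad_error_prodK => //.
- exact: measurable_weighted_domain.
- by move=> y; apply: integrable_weighted_domain; exact: integrable_prodK.
- by move=> y; rewrite Rintegral_weighted_domain ?Rintegral_prodK//; exact: integrable_prodK.
- by apply: integrable_weighted_domain; exact: integrable_prod_kmean.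
- rewrite Rintegral_weighted_domain; last exact: integrable_prod_kmean.
  exact: (Rintegral_prod_kmean HU hKmeas Ksym hM hmu).
Qed.

(** A real function on all of D^N (0 where the series diverges); it is the dominating function of
    every limit taken over the kernel series. *)
Definition weighted_diag x : R :=
  fine (\esum_(u in active gamma) (gamma u * prodK K u x x)%:E)%E.

Lemma weighted_diag_fin x : X x ->
  (\esum_(u in active gamma) (gamma u * prodK K u x x)%:E \is a fin_num)%E.
Proof. by move=> Xx; rewrite ge0_fin_numE// esum_ge0// => u _; rewrite lee_fin weighted_diag_ge0. Qed.

Lemma sum_weighted_diag_le x N : X x ->
  \sum_(u <- act N) gamma u * prodK K u x x <= weighted_diag x.
Proof.
move=> Xx; rewrite -lee_fin fineK; last exact: weighted_diag_fin.
apply: sum_le_esum; [by move=> u; exact: weighted_diag_ge0 | exact: enum_below_uniq|].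
by move=> u; exact: enum_below_sub.
Qed.

Lemma integrable_weighted_diag :
  mu.-integrable X (EFin \o (weighted_diag : powT nat (dom c) -> R)).
Proof.
apply: (eq_integrable measurable_weighted_domain (E : powT nat (dom c) -> \bar R)).
  by move=> x; rewrite inE => Xx; rewrite /= fineK//; exact: weighted_diag_fin.
by apply: (integrableS measurableT) => //; exact: measurable_weighted_domain.
Qed.

Lemma cvg_weighted_kernel x y : X x -> X y ->
  \sum_(u <- act N) gamma u * prodK K u x y @[N --> \oo] -->
  real_esum (active gamma) (fun u => gamma u * prodK K u x y).
Proof.
move=> Xx Xy.
apply: (cvg_sum_enum_below (G := fun u => gamma u * prodK K u x x + gamma u * prodK K u y y)).
  move=> u _; apply: le_trans (weighted_prodK_le u x y) _.
  have := weighted_diag_ge0 u x; have := weighted_diag_ge0 u y; lra.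
under eq_esum do rewrite EFinD.
rewrite esumD; [exact: lte_add_pinfty| |]; by move=> u _; rewrite lee_fin weighted_diag_ge0.
Qed.

Lemma weighted_kernel_diag x : X x ->
  real_esum (active gamma) (fun u => gamma u * prodK K u x x) = weighted_diag x.
Proof.
move=> Xx; have h := cvg_weighted_kernel Xx Xx.
have h2 := ge0_cvg_sum_enum_below_fine (fun u => weighted_diag_ge0 u x) Xx.
exact: (cvg_unique (@norm_hausdorff _ R) h h2).
Qed.

End weighted.

Lemma quad_error_cvg {R : realType} {T : Type} {disp} {Om : measurableType disp}
    (P : probability Om R) (X : set Om) (tau : Om -> T) (r : seq (R * T))
    (f_ : nat -> T -> R) (f : T -> R) (G : Om -> R) :
  measurable X -> (forall N, measurable_fun X (f_ N \o tau)) ->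
  (forall y, f_ N y @[N --> \oo] --> f y) ->
  (forall N w, X w -> `|f_ N (tau w)| <= G w) -> P.-integrable X (EFin \o G) ->
  quad_error P X tau r (f_ N) @[N --> \oo] --> quad_error P X tau r f.
Proof.
move=> mX mf cf fG iG.
have mlim : measurable_fun X (f \o tau) by apply: (measurable_fun_cvg mf) => w _; exact: cf.
have [||||ilim _ clim] := @dominated_convergence _ _ _ P X mX
  (fun N w => (f_ N (tau w))%:E) (EFin \o (f \o tau)) (EFin \o G) _ _ _ iG _.
- by move=> N; apply/measurable_EFinP; exact: mf.
- exact/measurable_EFinP.
- by apply: aeW => w _; apply: cvg_EFin; [exact: nearW | exact: cf].
- by apply: aeW => w N Xw /=; rewrite lee_fin; exact: fG.
apply: cvgB.
  have fin := integrable_fin_num mX ilim.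
  by move: clim; rewrite -(fineK fin) => /fine_cvg.
elim: r => [|p r ih].
  by rewrite big_nil; under eq_fun do rewrite big_nil; exact: cvg_cst.
rewrite big_cons; under eq_fun do rewrite big_cons.
by apply: cvgD => //; apply: cvgM; [exact: cvg_cst | exact: cf].
Qed.

Lemma quad_error_sum {R : realType} {T : Type} {disp} {Om : measurableType disp}
    (P : probability Om R) (X : set Om) (tau : Om -> T) (r : seq (R * T))
    (I : eqType) (s : seq I) (b : I -> R) (g : I -> T -> R) :
  measurable X -> (forall i, P.-integrable X (EFin \o (g i \o tau))) ->
  quad_error P X tau r (fun y => \sum_(i <- s) b i * g i y) =
  \sum_(i <- s) b i * quad_error P X tau r (g i).
Proof.
move=> mX ig; rewrite /quad_error Rintegral_sum//; last first.
  by move=> i _; apply: (integrableZl mX (b i) (ig i)).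
rewrite [X in _ - X](_ : _ = \sum_(i <- s) b i * \sum_(p <- r) p.1 * g i p.2).
  rewrite -sumrB; apply: eq_bigr => i _.
  by rewrite RintegralZl ?mulrBr//; exact: ig.
under eq_bigr do rewrite mulr_sumr.
rewrite exchange_big; apply: eq_bigr => i _; rewrite mulr_sumr.
by apply: eq_bigr => p _; rewrite mulrCA.
Qed.

(** * Worst-case error on the weighted space *)

Section weighted_error.
Context {R : realType} {D : set R} (c : D) (K : dom c -> dom c -> R).
Context (rho : probability (dom c) R) (mu : probability (powT nat (dom c)) R).
Context (gamma : {fset nat} -> R).
Context (Hgamma : rkhs (@weighted_kernel R D c K gamma)).
Hypothesis HU : forall u : {fset nat}, rkhs (prodK K u).
Hypothesis hKmeas : measurable_fun setT (fun z : dom c * dom c => K z.1 z.2).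
Hypothesis Ksym : forall a b, K a b = K b a.
Hypothesis hKc : K c c = 0.
Hypothesis hM : (\int[rho]_a (K a a)%:E < +oo)%E.
Hypothesis hmu : is_product_measure rho mu.
Hypothesis hgamma0 : forall u, 0 <= gamma u.
Hypothesis hgammaM :
  (\esum_(u in setT) (gamma u * diag_mean K rho ^+ #|` u|%fset)%:E < +oo)%E.

Local Notation X := (weighted_domain K gamma : set (powT nat (dom c))).
Local Notation XT := (weighted_domain K gamma).
Local Notation act := (enum_below (active gamma)).
Implicit Types (x y : nat -> dom c) (u v : {fset nat}) (r : seq (R * (nat -> dom c))).

Lemma anchor_in_weighted_domain : XT (fun=> c).
Proof. exact: (weighted_domain_finite_support HU hKc hgamma0 (v := fset0)). Qed.

(* Junk outside the weighted domain, over which alone integrals are taken. *)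
Definition to_weighted (x : powT nat (dom c)) : XT :=
  insubd (SigSub (mem_set anchor_in_weighted_domain)) (x : nat -> dom c).

Lemma to_weightedK x : XT x -> set_val (to_weighted x) = x.
Proof. by move=> Xx; apply: insubdK; rewrite inE. Qed.

Lemma valL_to_weighted (f : XT -> R) x : XT x -> 'valL_ (0 : R) f x = f (to_weighted x).
Proof.
move=> Xx; rewrite /valL_ oinv_set_val /to_weighted /insubd /=.
by case: insubP => [//|]; rewrite notin_setE.
Qed.

Lemma set_valP (y : XT) : XT (set_val y).
Proof. exact: set_mem (valP y). Qed.

Definition weighted_nodes r := [seq (p.1, to_weighted p.2) | p <- r].

Lemma quad_error_weighted_nodes r (g : (nat -> dom c) -> R) :
  (forall p, p \in map snd r -> XT p) ->
  quad_error mu X to_weighted (weighted_nodes r) (g \o set_val) = quad_error mu X id r g.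
Proof.
move=> rX; rewrite /quad_error big_map; congr (_ - _).
  by apply: eq_Rintegral => x; rewrite inE => Xx; rewrite /= to_weightedK.
elim: r rX => [|p r ih] rX; rewrite ?big_nil// !big_cons ih; last first.
  by move=> q qr; apply: rX; rewrite inE qr orbT.
by rewrite /= to_weightedK//; apply: rX; rewrite inE eqxx.
Qed.

Let mX : measurable X.
Proof. exact: (measurable_weighted_domain HU hKmeas hM hmu hgamma0). Qed.

(** The kernel inequality integrated over its first variable; it supplies the domination for the
    limit in the second variable. *)
Lemma prod_kmean_le u y :
  `|prod_kmean K rho u y| <= 2^-1 * (diag_mean K rho ^+ #|` u|%fset + prodK K u y y).
Proof.
rewrite -(Rintegral_prodK HU hKmeas hM hmu).
have i1 := integrable_prodK HU hKmeas hM hmu u y.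
have i2 := integrable_prodK_diag HU hKmeas hM hmu u.
have i3 : mu.-integrable setT (EFin \o cst (prodK K u y y)).
  exact: (finite_measure_integrable_cst mu (prodK K u y y) measurableT).
have i4 : mu.-integrable setT (EFin \o (fun x : powT nat (dom c) => prodK K u x x + prodK K u y y)).
  exact: (integrableD measurableT i2 i3).
apply: le_trans (le_normr_Rintegral measurableT i1) _.
rewrite -(Rintegral_prodK_diag HU hKmeas hM hmu).
rewrite -[X in _ + X](_ : \int[mu]_x (cst (prodK K u y y)) (x : powT nat (dom c)) = _); last first.
  by rewrite Rintegral_cst// [X in fine X](@probability_setT _ _ _ mu) mulr1.
rewrite -RintegralD// -RintegralZl//.
apply: le_Rintegral => //; first exact: integrable_norm.
  exact: (integrableZl measurableT 2^-1 i4).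
by move=> x _; exact: (rkhs_kernel_le (HU u)).
Qed.

Let mean_sum : R := fine (\esum_(u in setT) (gamma u * diag_mean K rho ^+ #|` u|%fset)%:E)%E.
Local Notation wd := (weighted_diag K gamma).

Lemma sum_weighted_prodK_le N x y : XT x -> XT y ->
  \sum_(u <- act N) `|gamma u * prodK K u x y| <= 2^-1 * (wd x + wd y).
Proof.
move=> Xx Xy; apply: (@le_trans _ _ (\sum_(u <- act N) (2^-1 * (gamma u * prodK K u x x + gamma u * prodK K u y y)))).
  by apply: ler_sum => u _; exact: (weighted_prodK_le HU hgamma0).
rewrite -mulr_sumr big_split/= ler_wpM2l ?invr_ge0// lerD//.
- exact: (sum_weighted_diag_le HU hgamma0).
- exact: (sum_weighted_diag_le HU hgamma0).
Qed.

Lemma sum_weighted_prod_kmean_le N y : XT y ->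
  \sum_(u <- act N) `|gamma u * prod_kmean K rho u y| <= 2^-1 * (mean_sum + wd y).
Proof.
move=> Xy; apply: (@le_trans _ _ (\sum_(u <- act N) (2^-1 * (gamma u * diag_mean K rho ^+ #|` u|%fset + gamma u * prodK K u y y)))).
  apply: ler_sum => u _; rewrite normrM ger0_norm// -mulrDr mulrCA ler_wpM2l//.
  exact: prod_kmean_le.
rewrite -mulr_sumr big_split/= ler_wpM2l ?invr_ge0// lerD//.
- exact: (sum_weighted_mean_le HU hgamma0 hgammaM).
- exact: (sum_weighted_diag_le HU hgamma0).
Qed.

(** The functional is applied to the partial sums of the kernel series, where it splits into the
    errors on the H_u. Two dominated limits, one per variable, then carry the uniform bound [B] to
    the full kernel. *)
Lemma quad_error_weighted_kernel_le r (B : R) :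
  (forall p, p \in map snd r -> XT p) ->
  (forall N, \sum_(u <- act N) gamma u * sq_error K rho u r <= B) ->
  quad_error mu X to_weighted (weighted_nodes r)
    (fun z : XT => quad_error mu X to_weighted (weighted_nodes r) (@weighted_kernel R D c K gamma ^~ z)) <= B.
Proof.
move=> rX rB; pose r' := weighted_nodes r.
have iK u y : mu.-integrable X (EFin \o ((prodK K u ^~ y) \o id : powT nat (dom c) -> R)).
  exact: (integrable_weighted_domain HU hKmeas hM hmu hgamma0 (integrable_prodK HU hKmeas hM hmu u y)).
have im u : mu.-integrable X (EFin \o (prod_kmean K rho u \o id : powT nat (dom c) -> R)).
  exact: (integrable_weighted_domain HU hKmeas hM hmu hgamma0 (integrable_prod_kmean HU hKmeas hM hmu u)).
pose q u y := quad_error mu X id r (prodK K u ^~ y).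
have qE u y : q u y = prod_kmean K rho u y - \sum_(p <- r) p.1 * prodK K u p.2 y.
  rewrite /q /quad_error (Rintegral_weighted_domain HU hKmeas hM hmu hgamma0 hgammaM).
    by rewrite (Rintegral_prodK HU hKmeas hM hmu).
  exact: (integrable_prodK HU hKmeas hM hmu u y).
have iq u : mu.-integrable X (EFin \o (q u \o id : powT nat (dom c) -> R)).
  have : mu.-integrable X ((EFin \o (prod_kmean K rho u \o id : powT nat (dom c) -> R))
     \- (EFin \o (fun x : powT nat (dom c) => \sum_(p <- r) p.1 * prodK K u p.2 x)%R))%E.
    apply: integrableB => //; apply: integrable_Rsum => // p _.
    have := integrableZl mX p.1 (iK u p.2); apply: eq_integrable => // x _.
    by rewrite /= (prodK_sym Ksym).
  by apply: eq_integrable => // x _; rewrite /= qE EFinB.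
have c1 (y : XT) : \sum_(u <- act N) gamma u * q u (set_val y) @[N --> \oo] -->
    quad_error mu X to_weighted r' (@weighted_kernel R D c K gamma ^~ y).
  have Xy := set_valP y.
  have -> : (fun N => \sum_(u <- act N) gamma u * q u (set_val y)) = (fun N =>
      quad_error mu X to_weighted r' ((fun x => \sum_(u <- act N) gamma u * prodK K u x (set_val y)) \o set_val)).
    by apply/funext => N; rewrite quad_error_weighted_nodes// quad_error_sum.
  apply: (quad_error_cvg (G := fun x : powT nat (dom c) => 2^-1 * (wd x + wd (set_val y)))) => //.
  - move=> N; have : mu.-integrable X (EFin \o (fun x : powT nat (dom c) =>
        \sum_(u <- act N) gamma u * prodK K u x (set_val y))).
      apply: integrable_Rsum => // u _; exact: (integrableZl mX (gamma u) (iK u (set_val y))).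
    move=> /(measurable_int mu)/measurable_EFinP; apply: eq_measurable_fun => x.
    by rewrite inE => Xx /=; rewrite to_weightedK.
  - move=> x; exact: (cvg_weighted_kernel HU hgamma0 (set_valP x) Xy).
  - move=> N x Xx; rewrite /= to_weightedK//.
    by apply: le_trans (ler_norm_sum _ _ _) _; exact: sum_weighted_prodK_le.
  - have i1 := integrable_weighted_diag HU hKmeas hM hmu hgamma0 hgammaM.
    have i2 := finite_measure_integrable_cst mu (wd (set_val y)) mX.
    exact: (integrableZl mX 2^-1 (integrableD mX i1 i2)).
(* Obtained from the one-variable error: its integral part is at most half of [mean_sum] plus the
   diagonal at y, and each node adds the modulus of its coefficient times half the sum of the
   diagonals at the node and at y. *)
pose a0 := 2^-1 * mean_sum + \sum_(p <- r) `|p.1| * (2^-1 * wd p.2).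
pose b0 := 2^-1 + \sum_(p <- r) `|p.1| * 2^-1.
have c2 := quad_error_cvg (P := mu) (X := X) (tau := to_weighted) (r := r')
  (f_ := fun N (z : XT) => \sum_(u <- act N) gamma u * q u (set_val z))
  (G := fun x : powT nat (dom c) => a0 + b0 * wd x) mX _ c1 _ _.
have c3 : quad_error mu X to_weighted r' (fun z : XT => \sum_(u <- act N) gamma u * q u (set_val z)) @[N --> \oo]
   --> quad_error mu X to_weighted r'
    (fun z : XT => quad_error mu X to_weighted r' (@weighted_kernel R D c K gamma ^~ z)).
  apply: c2.
  - move=> N; have : mu.-integrable X (EFin \o (fun x : powT nat (dom c) =>
        \sum_(u <- act N) gamma u * q u x)).
      apply: integrable_Rsum => // u _; exact: (integrableZl mX (gamma u) (iq u)).
    move=> /(measurable_int mu)/measurable_EFinP; apply: eq_measurable_fun => x.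
    by rewrite inE => Xx /=; rewrite to_weightedK.
  - move=> N y Xy; rewrite /= to_weightedK//.
    rewrite (eq_bigr (fun u => gamma u * prod_kmean K rho u y -
        \sum_(p <- r) p.1 * (gamma u * prodK K u p.2 y))); last first.
      by move=> u _; rewrite qE mulrBr mulr_sumr; congr (_ - _); apply: eq_bigr => p _; rewrite mulrCA.
    rewrite sumrB exchange_big/=; apply: le_trans (ler_normB _ _) _.
    have -> : a0 + b0 * wd y = 2^-1 * (mean_sum + wd y) +
        \sum_(p <- r) `|p.1| * (2^-1 * (wd p.2 + wd y)).
      rewrite (eq_bigr (fun p => `|p.1| * (2^-1 * wd p.2) + `|p.1| * 2^-1 * wd y)); last first.
        by move=> p _; ring.
      by rewrite big_split/= -mulr_suml /a0 /b0; ring.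
    apply: lerD.
      by apply: le_trans (ler_norm_sum _ _ _) _; exact: sum_weighted_prod_kmean_le.
    apply: le_trans (ler_norm_sum _ _ _) _; rewrite big_seq [leRHS]big_seq.
    apply: ler_sum => p pr; rewrite -mulr_sumr normrM ler_wpM2l//.
    apply: le_trans (ler_norm_sum _ _ _) _; apply: sum_weighted_prodK_le => //.
    by apply: rX; apply/mapP; exists p.
  - have i1 := integrable_weighted_diag HU hKmeas hM hmu hgamma0 hgammaM.
    have i2 := finite_measure_integrable_cst mu a0 mX.
    exact: (integrableD mX i2 (integrableZl mX b0 i1)).
apply: cvgr_to_le c3 _; apply: nearW => N.
rewrite (quad_error_weighted_nodes (fun y => \sum_(u <- act N) gamma u * q u y) rX) quad_error_sum//.
rewrite (eq_bigr (fun u => gamma u * sq_error K rho u r)); first exact: rB.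
by move=> u _; rewrite /q (quad_error_prodK_weighted HU hKmeas Ksym hM hmu hgamma0 hgammaM).
Qed.

(** Decouples the components: from here on only [sq_error] for the individual active sets has to be
    estimated. The nodes must lie in the weighted domain because functions are extended by 0 outside
    it. *)
Lemma alg_error_le (Q : algorithm c) r (E : R) :
  (forall f, @alg_apply R D c K gamma Q f = \sum_(p <- r) p.1 * 'valL_ (0 : R) f p.2) ->
  (forall p, p \in map snd r -> XT p) -> 0 <= E ->
  (forall N, \sum_(u <- act N) gamma u * sq_error K rho u r <= E ^+ 2) ->
  (alg_error mu Hgamma Q <= E%:E)%E.
Proof.
move=> Qr rX E0 rE; rewrite /alg_error.
apply: (worst_case_error_le (P := mu) (X := X) (tau := to_weighted) mX _ _ (r := weighted_nodes r)) => //.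
- move=> y; apply: (measurable_fun_cvg (h := fun N (x : powT nat (dom c)) =>
      \sum_(u <- act N) gamma u * prodK K u x (set_val y))) => [N|x Xx].
    apply: measurable_sum => u; apply: measurable_funM; first exact: measurable_cst.
    apply: measurable_funTS; apply/measurable_EFinP.
    exact: (measurable_int mu (integrable_prodK HU hKmeas hM hmu u (set_val y))).
  rewrite /weighted_kernel to_weightedK//.
  exact: (cvg_weighted_kernel HU hgamma0 Xx (set_valP y)).
- have := integrable_weighted_diag HU hKmeas hM hmu hgamma0 hgammaM.
  apply: eq_integrable => // x; rewrite inE => Xx.
  by rewrite /weighted_kernel /= to_weightedK// (weighted_kernel_diag HU hgamma0 Xx).
- move=> f Vf; rewrite Qr /integral /quad_error; congr (_ - _).
    by apply: eq_Rintegral => x; rewrite inE => Xx; rewrite valL_to_weighted.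
  rewrite big_map big_seq [RHS]big_seq; apply: eq_bigr => p pr.
  by rewrite valL_to_weighted//; apply: rX; apply/mapP; exists p.
- exact: quad_error_weighted_kernel_le.
Qed.

End weighted_error.

Local Open Scope fset_scope.
Local Open Scope ring_scope.

(** * Levels *)

(** A list of pairs (coefficient, v) stands for the combination of values at the point truncated to
    v. This sum is the factor by which the combination multiplies the component f_u. *)
Definition covering_sum {R : realType} (r : seq (R * {fset nat})) (u : {fset nat}) : R :=
  \sum_(p <- r | u `<=` p.2) p.1.

(** Expands the product over j in s of (keep j) - (anchor j): all subsets v of s, with sign (-1)^|s
    \ v|. *)
Fixpoint diff_terms {R : realType} (s : seq nat) : seq (R * {fset nat}) :=
  if s is j :: s' then
    [seq (p.1, j |` p.2) | p <- diff_terms s'] ++ [seq (- p.1, p.2) | p <- diff_terms s']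
  else [:: (1, fset0)].

Lemma diff_terms_sub {R : realType} s (p : R * {fset nat}) j :
  p \in diff_terms s -> j \in p.2 -> j \in s.
Proof.
elim: s p => [|i s ih] p /=; first by rewrite inE => /eqP -> /=; rewrite inE.
rewrite mem_cat => /orP[] /mapP[q qs ->] /=; last by rewrite inE => /(ih _ qs) ->; rewrite orbT.
by rewrite !inE => /orP[->//|/(ih _ qs) ->]; rewrite orbT.
Qed.

Lemma size_diff_terms {R : realType} s : size (@diff_terms R s) = (2 ^ size s)%N.
Proof. by elim: s => //= i s ih; rewrite size_cat !size_map ih expnS mul2n addnn. Qed.

(* Since f_u vanishes at a point truncated to v unless u is a subset of v, this
   says that [diff_terms s] recovers the component f_s. *)
Lemma covering_sum_diff_terms {R : realType} s u : uniq s ->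
  covering_sum (@diff_terms R s) u = (u == [fset j in s])%:R.
Proof.
rewrite /covering_sum; elim: s u => [|j s ih] u /=.
  move=> _; rewrite big_cons big_nil /= fsubset0 addr0.
  by rewrite (_ : [fset j in [::]] = fset0); [case: eqP | apply/fsetP => j; rewrite !inE].
move=> /andP[js us]; rewrite big_cat !big_map /=.
have sE : [fset x in j :: s] = j |` [fset x in s] by apply/fsetP => x; rewrite !inE.
(* If j is in u, only the sets containing j can cover u; otherwise the two halves of the list
   cancel. *)
have [ju|ju] := boolP (j \in u).
  rewrite [X in _ + X]big1_seq ?addr0; last first.
    move=> p /andP[/fsubsetP/(_ _ ju) jp ps].
    by rewrite (diff_terms_sub ps jp) in js.
  under eq_bigl do rewrite -fsubDset.
  rewrite ih// sE; congr (nat_of_bool _)%:R; apply/eqP/eqP => [<-|->]; first by rewrite fsetD1K.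
  by rewrite fsetU1K// inE.
rewrite [X in X + _](_ : _ = \sum_(p <- diff_terms s | u `<=` p.2) p.1); last first.
  by apply: eq_bigl => p; rewrite -fsubDset mem_fsetD1.
rewrite sumrN subrr sE; case: eqP => // ue.
by rewrite ue !inE eqxx in ju.
Qed.

Section levels.
Context {R : realType} (cost : nat -> R) (s : R) (A : set {fset nat}) (d : nat).
Hypothesis cost1 : forall k, 1 <= cost k.
Hypothesis cost_mono : forall k l, (k <= l)%N -> cost k <= cost l.
Hypothesis s0 : 0 <= s.
Hypothesis costO : cost =O_\oo (fun k : nat => k%:R `^ s).
Hypothesis Ad : forall u, A u -> (#|` u| <= d)%N.
Context (l : {fset nat} -> nat) (S : nat -> {fset {fset nat}}) (c0 : R).
Hypothesis SE : forall k u, u \in S k <-> A u /\ (l u <= k)%N.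
Hypothesis Scard : forall k, #|` S k|%:R <= c0 * 2 ^+ k.

(** Before the threshold of the O-bound, monotonicity of the cost takes over. The base 1 + k, rather
    than k, is needed at k = 0, where k^s may vanish while the cost is at least 1. *)
Lemma cost_growth : exists2 B : R, 0 <= B & forall k, cost k <= B * (1 + k%:R) `^ s.
Proof.
have /eqOP := costO => /pinfty_ex_gt0[B B0].
move=> [N _ HN]; exists (Num.max B (cost N)); first by rewrite le_max ltW.
have pos k : 1 <= (1 + k%:R) `^ s :> R.
  by rewrite -[leLHS](powRr0 (1 + k%:R)) ler_powR// lerDl.
move=> k; have [Nk|kN] := leqP N k.
  have := HN k Nk; rewrite /= ger0_norm ?(le_trans ler01)// ger0_norm ?powR_ge0// => h.
  apply: le_trans h _; apply: ler_pM; rewrite ?(ltW B0) ?powR_ge0 ?le_max ?lexx//.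
  by apply: ge0_ler_powR; rewrite ?nnegrE ?addr_ge0// lerDr.
apply: (@le_trans _ _ (cost N)); first exact/cost_mono/ltnW.
apply: (@le_trans _ _ (cost N * (1 + k%:R) `^ s)).
  by rewrite ler_peMr// (le_trans ler01).
by rewrite ler_wpM2r ?powR_ge0// le_max lexx orbT.
Qed.

Let c00 : 0 <= c0.
Proof. by have := Scard 0; rewrite expr0 mulr1; apply: le_trans. Qed.

(** [lev u] is the one level at which f_u is recovered. It may lie below [l u], since a union of
    active sets can cover further active sets; early recovery only helps. *)
Definition level_statement (sigma : R) :=
  exists (lev : {fset nat} -> nat) (ls : nat -> seq (R * {fset nat})) (CL : R),
  [/\ 0 <= CL, forall u, A u -> (lev u <= l u)%N,
      forall k u, A u -> covering_sum (ls k) u = (lev u == k)%:R &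
      forall k, \sum_(p <- ls k) cost #|` p.2| <= CL * (2 ^+ k) `^ sigma].

(** Exponent 1 because the number of sets is what grows: at most c0 2^k of them on level k, each
    with at most 2^d terms of cost at most [cost d]. *)
Lemma levels_by_sets : level_statement 1.
Proof.
pose ls (k : nat) : seq (R * {fset nat}) := flatten [seq diff_terms (enum_fset u) | u <- [seq u <- enum_fset (S k) | l u == k]].
exists l, ls, (c0 * (2 ^+ d * cost d)); split => //.
- by rewrite mulr_ge0// mulr_ge0// (le_trans ler01).
- move=> k u Au; rewrite /covering_sum /ls big_flatten/= big_map.
  rewrite (eq_bigr (fun v => (u == v)%:R)); last first.
    move=> v _; rewrite [LHS](covering_sum_diff_terms u (fset_uniq v)); congr (_%:R); congr (nat_of_bool (_ == _)).
    by apply/fsetP => j; rewrite !inE.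
  have [luk|luk] := eqVneq (l u) k.
    have uS : u \in [seq v <- enum_fset (S k) | l v == k].
      rewrite mem_filter luk eqxx; apply: (SE k u).2; split => //; exact: eq_leq.
    rewrite (bigD1_seq u uS)/=; last by rewrite filter_uniq// fset_uniq.
    by rewrite eqxx big1 ?addr0// => v; rewrite eq_sym => /negbTE ->.
  rewrite big1_seq// => v /=; rewrite mem_filter => /andP[/eqP lv _].
  by case: eqP => // uv; rewrite uv lv eqxx in luk.
move=> k; rewrite powRr1 ?exprn_ge0// big_flatten/= big_map big_filter.
have C0 : 0 <= 2 ^+ d * cost d by rewrite mulr_ge0// (le_trans ler01).
rewrite (@big_seq_cond R 0 +%R {fset nat} (enum_fset (S k))).
apply: (@le_trans _ _ (\sum_(u <- enum_fset (S k) | (u \in S k) && (l u == k)) (2 ^+ d * cost d))).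
  apply: ler_sum => u /andP[uS _].
  have ud : (#|` u| <= d)%N by apply: Ad; have [] := (SE k u).1 uS.
  apply: (@le_trans _ _ (\sum_(p <- @diff_terms R (enum_fset u)) cost d)).
    rewrite big_seq [leRHS]big_seq; apply: ler_sum => p pD.
    apply: cost_mono; apply: leq_trans ud; apply: fsubset_leq_card.
    by apply/fsubsetP => j; exact: diff_terms_sub.
  rewrite big_const_seq count_predT size_diff_terms iter_addr_0 -[leLHS]mulr_natl natrX.
  by rewrite ler_wpM2r ?(le_trans ler01)// ler_eXn2l// ltr1n.
rewrite big_const_seq iter_addr_0 -[leLHS]mulr_natl mulrAC ler_wpM2r//.
by apply: le_trans (Scard k); rewrite ler_nat count_size.
Qed.

(** Here each level has at most two terms, and the growth comes from the size of the union, at most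
    d c0 2^k coordinates. The unions are nested, so being covered is a threshold condition on k. *)
Lemma levels_by_unions : level_statement s.
Proof.
have [B B0 HB] := cost_growth.
pose v k := (\bigcup_(u <- enum_fset (S k)) u)%fset.
have vP k u : u \in S k -> u `<=` v k by move=> uS; exact: bigfcup_sup.
have vmono k k' : (k <= k')%N -> v k `<=` v k'.
  move=> kk'; apply/bigfcupsP => u uS _; apply: vP; apply: (SE k' u).2.
  by have [Au lu] := (SE k u).1 uS; split => //; exact: leq_trans kk'.
have vcard k : #|` v k|%:R <= d%:R * (c0 * 2 ^+ k).
  apply: (@le_trans _ _ (\sum_(u <- enum_fset (S k)) #|` u|)%:R).
    rewrite ler_nat /v; elim: (enum_fset (S k)) => [|u r ih]; first by rewrite !big_nil cardfs0.
    by rewrite !big_cons cardfsU (leq_trans (leq_subr _ _))// leq_add2l.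
  apply: (@le_trans _ _ (d * #|` S k|)%:R); last by rewrite natrM ler_wpM2l.
  rewrite ler_nat big_seq; apply: (@leq_trans (\sum_(u <- enum_fset (S k)) d)%N).
    by rewrite [leqRHS]big_seq; apply: leq_sum => u uS; apply: Ad; have [] := (SE k u).1 uS.
  by rewrite big_const_seq count_predT iter_addn_0.
(* The first union that covers u; the default 0 never concerns an active set, which is covered by
   the union of index [l u]. *)
pose lev u := if pselect (exists k, u `<=` v k) is left ex then ex_minn ex else 0%N.
pose ls (k : nat) : seq (R * {fset nat}) := (1, v k) :: (if k is k'.+1 then [:: (-1, v k')] else [::]).
have Av u : A u -> u `<=` v (l u) by move=> Au; apply: vP; apply: (SE _ _).2.
have levP u : A u -> forall k, (u `<=` v k) = (lev u <= k)%N.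
  move=> Au k; rewrite /lev; case: pselect => [ex|[]]; last by exists (l u); exact: Av.
  case: ex_minnP => m um mmin; apply/idP/idP => [|mk]; first exact: mmin.
  exact: fsubset_trans (vmono _ _ mk).
exists lev, ls, (2 * (B * (1 + d%:R * c0) `^ s)); split.
- by rewrite !mulr_ge0// powR_ge0.
- by move=> u Au; rewrite -levP// Av.
- move=> k u Au; rewrite /covering_sum /ls big_cons levP// eqn_leq.
  case: k => [|k]; first by rewrite big_nil leqn0 andbT; case: eqP => // _; rewrite addr0.
  rewrite big_cons big_nil levP// addr0 [(k < _)%N]ltnNge.
  case: (leqP (lev u) k) => [h|h]; first by rewrite leqW// subrr andbF.
  by rewrite andbT; case: leqP => // _; rewrite addr0.
move=> k.
(* The 1 in the growth bound is absorbed by 1 + d c0 2^k <= (1 + d c0) 2^k. The factor 2 in the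
   witness pays for the second union, which is smaller. *)
have vc : cost #|` v k| <= B * (1 + d%:R * c0) `^ s * (2 ^+ k) `^ s.
  apply: le_trans (HB _) _; rewrite -mulrA ler_wpM2l// -powRM ?addr_ge0 ?mulr_ge0 ?exprn_ge0//.
  apply: ge0_ler_powR; rewrite ?nnegrE ?addr_ge0 ?mulr_ge0 ?addr_ge0 ?mulr_ge0 ?exprn_ge0//.
  rewrite mulrDl mul1r; apply: lerD; last by rewrite -mulrA.
  by apply: exprn_ege1; rewrite ler1n.
have cle : \sum_(p <- (if k is k'.+1 then [:: (-1, v k')] else [::]) : seq (R * {fset nat})) cost #|` p.2| <= cost #|` v k|.
  case: k {vc} => [|k]; first by rewrite big_nil (le_trans ler01).
  rewrite big_cons big_nil addr0; apply: cost_mono; apply: fsubset_leq_card.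
  exact: vmono.
rewrite /ls big_cons /=.
by have := lerD vc (le_trans cle vc); lra.
Qed.
End levels.

Lemma sum_uniq_subset_le {R : realDomainType} (I : eqType) (s t : seq I) (F : I -> R) :
  uniq s -> {subset s <= t} -> (forall i, i \in t -> 0 <= F i) ->
  \sum_(i <- s) F i <= \sum_(i <- t) F i.
Proof.
elim: s t => [|x s ih] t /=.
  by move=> _ _ F0; rewrite big_nil big_seq; apply: sumr_ge0.
move=> /andP[xs us] st F0; have xt : x \in t by apply: st; rewrite mem_head.
rewrite big_cons (big_rem x xt)/= lerD2l; apply: ih => //.
- move=> y ys; have yt : y \in t by apply: st; rewrite inE ys orbT.
  have := perm_mem (perm_to_rem xt) y; rewrite yt inE => /esym/orP[/eqP yx|//].
  by rewrite -yx ys in xs.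
- by move=> y /mem_rem; exact: F0.
Qed.

Lemma geometric_sum_le {R : realFieldType} (x : R) N : 0 <= x -> x < 1 ->
  \sum_(i < N) x ^+ i <= (1 - x)^-1.
Proof.
move=> x0 x1; have h : 0 < 1 - x by rewrite subr_gt0.
rewrite -[leRHS]mul1r ler_pdivlMr// mulrC.
have := subrX1 x N; rewrite -opprB -[x - 1]opprB mulNr => /oppr_inj <-.
by rewrite gerBl exprn_ge0.
Qed.

Lemma powR2X {R : realType} (k : nat) (x : R) : (2 ^+ k) `^ x = (2 `^ x) ^+ k.
Proof. by rewrite -powR_mulrn// -powRrM mulrC powRrM powR_mulrn// powR_ge0. Qed.

(** Cauchy condensation: exactly 2^l ranks have l as integer part of log_2. Ranks are j + 1, which
    explains the upper limit 2^N - 1. *)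
Lemma sum_trunc_log2 {R : realDomainType} (f : nat -> R) N :
  \sum_(0 <= j < (2 ^ N).-1) f (trunc_log 2 j.+1) = \sum_(l < N) 2 ^+ l * f l.
Proof.
elim: N => [|N ih]; first by rewrite big_geq// big_ord0.
have p0 : (0 < 2 ^ N)%N by rewrite expn_gt0.
rewrite (big_cat_nat (n := (2 ^ N).-1))//=; last first.
  by rewrite expnS mul2n -addnn; case: (2 ^ N)%N p0 => // m _; rewrite /= addnS leqW// leq_addr.
rewrite ih big_ord_recr /=; congr (_ + _).
rewrite (eq_big_nat _ _ (F2 := fun=> f N)); last first.
  move=> j /andP[j1 j2]; congr f; apply: trunc_log_eq => //.
  rewrite -[X in (_ <= _ < X)%N](@prednK (2 ^ N.+1)) ?expn_gt0// ltnS j2 andbT.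
  by rewrite -(@prednK (2 ^ N)).
rewrite sumr_const_nat -[LHS]mulr_natl; congr (_ * _).
rewrite -natrX; congr (_%:R).
by rewrite expnS mul2n -addnn; case: (2 ^ N)%N p0 => // m _; rewrite /= addnS -addSn addnK.
Qed.

(** * Dyadic blocks of active sets and summability of the weights *)

Section block_index.
Context {R : realType} (gamma : {fset nat} -> R) (C0 : R) (d : nat) (q : R).
Hypothesis gamma0 : forall u, 0 <= gamma u.
Hypothesis C00 : 0 < C0.
Hypothesis gd : forall u, active gamma u -> (#|` u| <= d)%N.
Hypothesis q0 : 0 <= q.
Hypothesis hq : ((1 + q)%:E < decay gamma C0)%E.

(** Decay is a statement about the scaled weights. Going back to gamma costs C_0^(-|u|), harmless
    for C_0 >= 1 and at most C_0^(-d) otherwise. *)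
Lemma gamma_le_scaled : exists2 B : R, 0 <= B & forall u, active gamma u ->
  gamma u <= B * scaled_weight gamma C0 u.
Proof.
have [C1|C1] := leP 1 C0.
  exists 1 => // u _; rewrite mul1r /scaled_weight ler_peMr//.
  exact: exprn_ege1.
exists (C0 ^- d); first by rewrite invr_ge0 exprn_ge0// ltW.
move=> u Au; rewrite /scaled_weight mulrCA ler_peMr//.
rewrite -ler_pdivrMl ?invr_gt0 ?exprn_gt0// invrK mulr1.
by apply: ler_wiXn2l; rewrite ?(ltW C00) ?(ltW C1)//; exact: gd.
Qed.

(** The supremum in [decay] provides an exponent p > 1 + q, so a set in block t has gamma_u 2^(q t)
    of order 2^((q - p) t); the 2^t sets of the block leave a convergent geometric series. Bounds on
    all finite lists replace an infinite sum. If only finitely many sets are active, one block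
    suffices. *)
Lemma block_index_exists : exists (l : {fset nat} -> nat) (S : nat -> {fset {fset nat}}) (c0 Z : R),
  [/\ forall k u, u \in S k <-> active gamma u /\ (l u <= k)%N,
      forall k, #|` S k|%:R <= c0 * 2 ^+ k &
      forall s : seq {fset nat}, uniq s -> (forall u, u \in s -> active gamma u) ->
        \sum_(u <- s) gamma u * (2 ^+ l u) `^ q <= Z].
Proof.
have [fin|inf] := pselect (finite_set (nonempty_active gamma)).
  have finA : finite_set (active gamma).
    apply: (@sub_finite_set _ _ ([set fset0] `|` nonempty_active gamma)%classic).
      by move=> u Au; have [->|u0] := eqVneq u fset0; [left | right].
    by rewrite finite_setU; split.
  exists (fun=> 0%N), (fun=> fset_set (active gamma)), #|` fset_set (active gamma)|%:R,
    (\sum_(u <- fset_set (active gamma)) gamma u); split.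
  - move=> k u; rewrite in_fset_set// inE; split; first by move=> Au; split.
    by case.
  - by move=> k; rewrite ler_peMr// exprn_ege1// ler1n.
  - move=> s us sA; rewrite (eq_bigr gamma); last by move=> u _; rewrite expr0 powR1 mulr1.
    apply: sum_uniq_subset_le => // u /sA Au.
    by rewrite -[_ \in _]/(u \in fset_set (active gamma)) in_fset_set// inE.
move: hq; rewrite /decay asboolF// => /ereal_sup_gt[_ [p [e [einj erng emono] ecvg] <-]].
rewrite lte_fin => qp.
have /cvgP/cvg_seq_bounded/pinfty_ex_gt0[B B0 HB] := ecvg.
have [B' B'0 HB'] := gamma_le_scaled.
have eA j : nonempty_active gamma (e j) by rewrite -erng; exists j.
(* The enumeration omits the empty set; the default 0 puts it into block 0. *)
pose idx u := xget 0%N [set j | e j = u]%classic.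
have idxE j : idx (e j) = j by apply: einj; exact: (@xgetPex _ 0%N [set i | e i = e j]%classic (ex_intro _ j erefl)).
have idx0 : idx fset0 = 0%N.
  by apply: xgetPN => j /= ej; have [] := eA j; rewrite ej eqxx.
have act_cases u : active gamma u -> u = fset0 \/ exists j, u = e j.
  move=> Au; have [->|u0] := eqVneq u fset0; [by left | right].
  have : nonempty_active gamma u by split.
  by rewrite -erng => -[j _ <-]; exists j.
pose l u := trunc_log 2 (idx u).+1.
have lE u k : (l u <= k)%N = (idx u < (2 ^ k.+1).-1)%N.
  rewrite -(ltn_add2r 1) !addn1 prednK ?expn_gt0//.
  apply/idP/idP => h.
    apply: leq_trans (trunc_log_ltn _ (ltnSn 1)) _.
    by rewrite leq_exp2l.
  by rewrite -ltnS -(ltn_exp2l _ _ (ltnSn 1)); apply: leq_ltn_trans h; exact: trunc_logP.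
pose S k := [fset u in fset0 :: [seq e j | j <- iota 0 (2 ^ k.+1).-1] | `[< active gamma u >]].
(* The ratio 2^(q - p) by which the bound on a term shrinks from block to block (not the measure).
   Blocks double in size, so 2 rho < 1 is required, which is p > 1 + q. *)
pose rho := 2 `^ q / 2 `^ p : R.
have p2 : 0 < 2 `^ p :> R by rewrite powR_gt0.
have rho0 : 0 <= rho by rewrite divr_ge0// powR_ge0.
have rho1 : 2 * rho < 1.
  rewrite /rho mulrA ltr_pdivrMr// mul1r -{1}(@powRr1 _ 2)// -powRD; last by rewrite pnatr_eq0 implybT.
  by rewrite -ltr_ln ?posrE ?powR_gt0// !ln_powR ltr_pM2r// ln_gt0// ltr1n.
(* The constant 2 arises because [S k] consists at most of the empty set and the first 2^(k+1) - 1
   enumerated sets. In the last witness the empty set is counted separately. *)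
exists l, S, 2, (gamma fset0 + B' * B * (1 - 2 * rho)^-1); split.
- move=> k u; rewrite !inE /=; split.
    move=> /andP[ut /asboolP Au]; split => //; rewrite lE.
    move: ut => /orP[/eqP ->|/mapP[j]].
      by rewrite idx0 -ltnS prednK ?expn_gt0// (leq_ltn_trans _ (ltn_expl k.+1 (ltnSn 1))).
    by rewrite mem_iota add0n => jk ->; rewrite idxE.
  move=> [Au]; rewrite lE => lu; apply/andP; split; last exact/asboolP.
  have [->|[j uj]] := act_cases _ Au; first by rewrite eqxx.
  apply/orP; right; apply/mapP; exists j => //.
  by rewrite mem_iota add0n; move: lu; rewrite uj idxE.
- move=> k; apply: (@le_trans _ _ (size (fset0 :: [seq e j | j <- iota 0 (2 ^ k.+1).-1]))%:R).
    rewrite ler_nat; apply: uniq_leq_size; first exact: fset_uniq.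
    by move=> u; rewrite -[_ \in enum_fset _]/(u \in S k) inE => /andP[].
  by rewrite /= size_map size_iota prednK ?expn_gt0// natrX exprS.
move=> s us sA.
pose F u := gamma u * (2 ^+ l u) `^ q.
have F0 u : 0 <= F u by rewrite mulr_ge0// powR_ge0.
pose M := (\max_(u <- s) idx u)%N.
apply: (@le_trans _ _ (\sum_(u <- fset0 :: [seq e j | j <- iota 0 (2 ^ M.+1).-1]) F u)).
  apply: sum_uniq_subset_le; [exact: us | move=> u uin | by move=> u _; exact: F0].
  have [->|[j uj]] := act_cases _ (sA _ uin); rewrite inE ?eqxx//.
  apply/orP; right; apply/mapP; exists j => //.
  rewrite mem_iota add0n -(ltn_add2r 1) !addn1 prednK ?expn_gt0//.
  apply: leq_ltn_trans (ltn_expl M.+1 (ltnSn 1)); rewrite ltnS -(idxE j) -uj.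
  exact: (leq_bigmax_seq u uin isT).
have Fe j : F (e j) <= B' * B * rho ^+ trunc_log 2 j.+1.
  rewrite /F /l idxE; set t := trunc_log 2 j.+1.
  have Ae : active gamma (e j) by have [] := eA j.
  have tj : 2 ^+ t <= j.+1%:R :> R by rewrite -natrX ler_nat; exact: trunc_logP.
  have hj : scaled_weight gamma C0 (e j) <= B / (2 `^ p) ^+ t.
    rewrite ler_pdivlMr ?exprn_gt0//; apply: le_trans (HB j I).
    apply: le_trans (ler_norm _); rewrite ler_wpM2l//.
      by rewrite mulr_ge0// exprn_ge0// ltW.
    rewrite -powR2X; apply: ge0_ler_powR; rewrite ?nnegrE ?exprn_ge0//.
    by apply: le_trans (ltW qp); rewrite addr_ge0.
  rewrite powR2X /rho expr_div_n.
  apply: (@le_trans _ _ (B' * (B / (2 `^ p) ^+ t) * (2 `^ q) ^+ t)).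
    rewrite ler_wpM2r ?exprn_ge0 ?powR_ge0//.
    by apply: le_trans (HB' _ Ae) _; rewrite ler_wpM2l.
  by rewrite le_eqVlt; apply/orP; left; apply/eqP; field; rewrite gt_eqF// exprn_gt0.
rewrite big_cons; apply: lerD.
  by rewrite /F /l idx0 (_ : trunc_log 2 1 = 0%N)// expr0 powR1 mulr1.
rewrite big_map -{1}[(2 ^ M.+1).-1]subn0 -/(index_iota 0 (2 ^ M.+1).-1).
apply: le_trans (ler_sum _ (fun j _ => Fe j)) _.
rewrite (sum_trunc_log2 (fun t => B' * B * rho ^+ t)).
rewrite (eq_bigr (fun t : 'I_M.+1 => B' * B * (2 * rho) ^+ t)); last first.
  by move=> t _; rewrite [in RHS]exprMn mulrCA.
rewrite -mulr_sumr ler_wpM2l ?mulr_ge0 ?(ltW B0)//.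
by apply: geometric_sum_le => //; rewrite mulr_ge0.
Qed.
End block_index.

(** * Admissible algorithms built from lists of truncated points *)

Section list_algorithm.
Context {R : realType} {D : set R} (c : D).
Implicit Types (x : nat -> dom c) (v : {fset nat}).

Definition anchor_at v x : nat -> dom c := fun j => if j \in v then x j else c.

Context (rr : seq (R * {fset nat} * (nat -> dom c))).

(** Nodes of an admissible algorithm have no coordinate equal to [c]. Dropping such coordinates from
    the support does not change the anchored point and can only lower the cost. *)
Definition list_supp (i : 'I_(size rr)) : {fset nat} :=
  let e := tnth (in_tuple rr) i in [fset j in e.1.2 | e.2 j != c].

Definition list_pt (i : 'I_(size rr)) (j : list_supp i) : dom c :=
  (tnth (in_tuple rr) i).2 (val j).

Lemma list_pt_neq i (j : list_supp i) : list_pt j <> c.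
Proof. by have := valP j; rewrite !inE /= => /andP[_ /eqP]. Qed.

Definition list_algorithm : algorithm c :=
  @Algorithm R D c (size rr) (fun i => (tnth (in_tuple rr) i).1.1) list_supp list_pt list_pt_neq.

Lemma anchored_list_pt i :
  anchored (@list_pt i) = anchor_at (tnth (in_tuple rr) i).1.2 (tnth (in_tuple rr) i).2.
Proof.
apply/funext => j; rewrite /anchor_at; set e := tnth _ _.
have [ji|ji] := boolP (j \in list_supp i).
  have jv : j \in e.1.2 by move: (ji); rewrite !inE /= -/e => /andP[].
  by rewrite jv; exact: (anchored_in (@list_pt i) [` ji]%fset).
rewrite anchored_out//; move: ji; rewrite !inE /= -/e negb_and negbK.
by case: ifP => //= _ /eqP ->.
Qed.

Lemma list_algorithm_apply (K : dom c -> dom c -> R) gamma (f : weighted_domain K gamma -> R) :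
  alg_apply list_algorithm f =
  \sum_(p <- [seq (e.1.1, anchor_at e.1.2 e.2) | e <- rr]) p.1 * 'valL_ (0 : R) f p.2.
Proof.
rewrite big_map [RHS]big_tnth /alg_apply /=; apply: eq_bigr => i _.
by rewrite anchored_list_pt.
Qed.

Lemma list_algorithm_cost (cost : nat -> R) : (forall k l, (k <= l)%N -> cost k <= cost l) ->
  cost_unr cost list_algorithm <= \sum_(e <- rr) cost #|` e.1.2|.
Proof.
move=> mono; rewrite /cost_unr /= [leRHS]big_tnth; apply: ler_sum => i _.
apply: mono; apply: fsubset_leq_card; apply/fsubsetP => j.
by rewrite !inE => /andP[].
Qed.

End list_algorithm.

(** * The multilevel algorithm: its error on each component and its cost *)

Section multilevel.
Context {R : realType} {D : set R} (c : D) (K : dom c -> dom c -> R).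
Context (rho : probability (dom c) R).
Hypothesis HU : forall u : {fset nat}, rkhs (prodK K u).
Hypothesis Ksym : forall a b, K a b = K b a.
Hypothesis hKc : K c c = 0.
Implicit Types (u v : {fset nat}) (x y : nat -> dom c) (r : seq (R * (nat -> dom c))).

Lemma prod_anchor_at u v x (g : nat -> dom c -> R) : (forall j, g j c = 0) ->
  \prod_(j <- u) g j (anchor_at v x j) = (u `<=` v)%:R * \prod_(j <- u) g j (x j).
Proof.
move=> gc; have [/fsubsetP uv|/fsubsetPn[j ju jv]] := boolP (u `<=` v).
  rewrite mul1r big_seq [RHS]big_seq; apply: eq_bigr => j ju.
  by rewrite /anchor_at uv.
by rewrite mul0r (big_fsetD1 j)//= /anchor_at (negbTE jv) gc mul0r.
Qed.

Lemma kmean_anchor : kmean K rho c = 0.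
Proof.
rewrite /kmean; under eq_Rintegral do rewrite Ksym (K_anchor HU hKc).
by rewrite Rintegral_cst// mul0r.
Qed.

Lemma prod_kmean_anchor_at u v x : prod_kmean K rho u (anchor_at v x) = (u `<=` v)%:R * prod_kmean K rho u x.
Proof. by apply: (@prod_anchor_at u v x (fun=> kmean K rho)) => _; exact: kmean_anchor. Qed.

Lemma prodK_anchor_at u v x y : prodK K u (anchor_at v x) y = (u `<=` v)%:R * prodK K u x y.
Proof. by apply: (@prod_anchor_at u v x (fun j a => K a (y j))) => j; exact: (K_anchor HU hKc). Qed.

(* [sq_error K rho u r] only involves functions that vanish as soon as one of
   the coordinates in u is anchored. *)
Lemma sq_error_congr u r r' :
  (forall G : (nat -> dom c) -> R, (forall v x, G (anchor_at v x) = (u `<=` v)%:R * G x) ->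
     \sum_(p <- r) p.1 * G p.2 = \sum_(p <- r') p.1 * G p.2) ->
  sq_error K rho u r = sq_error K rho u r'.
Proof.
move=> h; rewrite /sq_error (h (prod_kmean K rho u)); last exact: prod_kmean_anchor_at.
congr (_ + _).
rewrite (eq_bigr (fun p => p.1 * \sum_(q <- r') q.1 * prodK K u q.2 p.2)); last first.
  by move=> p _; rewrite (h (prodK K u ^~ p.2))// => v x; exact: prodK_anchor_at.
rewrite (h (fun y => \sum_(q <- r') q.1 * prodK K u q.2 y))// => v x.
rewrite mulr_sumr; apply: eq_bigr => q _.
by rewrite (prodK_sym Ksym) prodK_anchor_at (prodK_sym Ksym) mulrCA.
Qed.

Context (ls : nat -> seq (R * {fset nat})) (nn : nat -> nat).
Context (a : forall n : nat, 'I_n -> R) (z : forall n : nat, 'I_n -> nat -> dom c).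

Definition multilevel (L : nat) : seq (R * {fset nat} * (nat -> dom c)) :=
  flatten [seq flatten [seq [seq (a i * p.1, p.2, z i) | p <- ls k] | i <- enum 'I_(nn (L - k))]
          | k <- iota 0 L.+1].

Definition level_nodes n : seq (R * (nat -> dom c)) := [seq (a i, z i) | i <- enum 'I_n].

(** Every other level multiplies f_u by 0. On f_u the algorithm is therefore the single quadrature
    of level [lev], or the zero algorithm if that level is beyond [L]. *)
Lemma sq_error_multilevel L u lev :
  (forall k, covering_sum (ls k) u = (lev == k)%:R) ->
  sq_error K rho u [seq (e.1.1, anchor_at e.1.2 e.2) | e <- multilevel L] =
  if (lev <= L)%N then sq_error K rho u (level_nodes (nn (L - lev))) else sq_error K rho u [::].
Proof.
move=> hlev; rewrite -fun_if; apply: sq_error_congr => G hG.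
rewrite big_map /multilevel big_flatten big_map; set ks := iota _ _ => /=.
rewrite (eq_bigr (fun k => (lev == k)%:R * \sum_(p <- level_nodes (nn (L - k))) p.1 * G p.2)); last first.
  move=> k _; rewrite big_flatten/= big_map /level_nodes big_map -hlev mulr_sumr.
  apply: eq_bigr => i _; rewrite big_map /= /covering_sum mulr_suml [RHS]big_mkcond/=.
  apply: eq_bigr => p _; rewrite hG; case: ifP => _; rewrite ?mul1r ?mul0r ?mulr0// mulrA; congr (_ * _); exact: mulrC.
case: ifPn => [lL|lL].
  have lin : lev \in ks by rewrite mem_iota.
  rewrite (bigD1_seq lev lin (iota_uniq _ _))/= eqxx mul1r [X in _ + X]big1 ?addr0// => k.
  by rewrite eq_sym => /negbTE ->; rewrite mul0r.
rewrite big_nil big1_seq// => k; rewrite mem_iota add0n ltnS => /= kL.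
by case: eqP => [lk|_]; [rewrite lk kL in lL | rewrite mul0r].
Qed.

Lemma multilevel_cost (cost : nat -> R) L :
  \sum_(e <- multilevel L) cost #|` e.1.2| =
  \sum_(0 <= k < L.+1) (nn (L - k))%:R * \sum_(p <- ls k) cost #|` p.2|.
Proof.
rewrite /multilevel big_flatten big_map /index_iota subn0; apply: eq_bigr => k _.
rewrite big_flatten/= big_map.
rewrite (eq_bigr (fun=> \sum_(p <- ls k) cost #|` p.2|)); last by move=> i _; rewrite big_map.
by rewrite big_const_seq count_predT size_enum_ord iter_addr_0 -[LHS]mulr_natl.
Qed.

End multilevel.

(** * Exponent of tractability *)

Section powers.
Context {R : realType}.
Implicit Types (x y : R).

Lemma log_powR_absorb (beta delta : R) : 0 <= beta -> 0 < delta ->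
  exists2 B : R, 0 <= B & forall x, 1 <= x -> (1 + ln x) `^ beta <= B * x `^ delta.
Proof.
(* From ln x <= x^e / e, raised to the power beta; e beta <= delta holds for this e, and beta + 1
   avoids division by zero. *)
move=> b0 d0; pose e := delta / (beta + 1).
have e0 : 0 < e by rewrite divr_gt0// ltr_wpDl.
have B0 : 0 <= 1 + e^-1 by rewrite addr_ge0// invr_ge0 ltW.
exists ((1 + e^-1) `^ beta); first exact: powR_ge0.
move=> x x1; have x0 : 0 < x by exact: lt_le_trans x1.
have xe1 : 1 <= x `^ e by rewrite -[leLHS](powRr0 x) ler_powR// ltW.
have h : 1 + ln x <= (1 + e^-1) * x `^ e.
  rewrite mulrDl mul1r lerD// ler_pdivlMl// -ln_powR ltW// ln_sublinear//.
  exact: lt_le_trans xe1.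
apply: (@le_trans _ _ (((1 + e^-1) * x `^ e) `^ beta)).
  by apply: ge0_ler_powR; rewrite ?nnegrE ?addr_ge0 ?ln_ge0 ?mulr_ge0 ?powR_ge0.
rewrite powRM ?powR_ge0// -powRrM ler_wpM2l ?powR_ge0// ler_powR//.
rewrite /e mulrAC ler_pdivrMr ?ltr_wpDl// ler_wpM2l ?(ltW d0)//.
by rewrite lerDl.
Qed.

(** The logarithms cost an arbitrarily small part of the rate. The constant is uniform in k <= d,
    which covers all active sets at once. *)
Lemma error_bound_absorb (c1 C alpha beta1 beta2 theta : R) (d : nat) :
  0 <= c1 -> 0 <= C -> 0 <= beta1 -> 0 <= beta2 -> theta < alpha ->
  exists2 B : R, 0 <= B & forall n k : nat, (k <= d)%N ->
    c1 * C ^+ k * n.+1%:R `^ (- alpha) * (1 + ln n.+1%:R) `^ (beta1 * k%:R + beta2)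
    <= B * n.+1%:R `^ (- theta).
Proof.
move=> c10 C0 b10 b20 ta.
have [B B0 HB] := @log_powR_absorb (beta1 * d%:R + beta2) (alpha - theta)
  (addr_ge0 (mulr_ge0 b10 (ler0n _ _)) b20) (ltac:(by rewrite subr_gt0)).
have M1 : 1 <= Num.max 1 C by rewrite le_max lexx.
exists (c1 * Num.max 1 C ^+ d * B).
  by rewrite !mulr_ge0// exprn_ge0// (le_trans ler01).
move=> n k kd; have n1 : 1 <= n.+1%:R :> R by rewrite ler1n.
have -> : n.+1%:R `^ (- theta) = n.+1%:R `^ (- alpha) * n.+1%:R `^ (alpha - theta) :> R.
  rewrite -powRD; last by rewrite pnatr_eq0 implybT.
  by congr (_ `^ _); ring.
rewrite -!mulrA ler_wpM2l//.
rewrite [leRHS](_ : _ = Num.max 1 C ^+ d * (n.+1%:R `^ (- alpha) * (B * n.+1%:R `^ (alpha - theta)))); last by ring.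
apply: ler_pM; rewrite ?exprn_ge0 ?mulr_ge0 ?powR_ge0//.
  apply: (@le_trans _ _ (Num.max 1 C ^+ k)); last exact: ler_weXn2l.
  by apply: lerXn2r; rewrite ?nnegrE ?le_max ?lexx ?ler01 ?orbT.
rewrite ler_wpM2l ?powR_ge0//; apply: le_trans (HB _ n1).
apply: ler_powR; first by rewrite lerDl ln_ge0.
by rewrite lerD2r ler_wpM2l// ler_nat.
Qed.

End powers.

Lemma card_upto d : #|` upto d| = d.
Proof. by rewrite /upto card_fseq undup_id ?iota_uniq// size_iota. Qed.

(** * Choice of the parameters and the bound on the complexity *)

Section tractability_bound.
Context (R : realType) (D : set R) (c : D) (K : dom c -> dom c -> R).
Context (rho : probability (dom c) R) (mu : probability (powT nat (dom c)) R).
Context (rhoU : forall u : {fset nat}, probability (powT u (dom c)) R).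
Context (gamma : {fset nat} -> R) (HU : forall u : {fset nat}, rkhs (prodK K u)).
Context (Hgamma : rkhs (@weighted_kernel R D c K gamma)).
Context (cost : nat -> R) (s : R) (W : set {fset nat}) (d : nat).
Context (alpha c1 C beta1 beta2 : R) (a : forall n : nat, 'I_n -> R).
Context (t : forall n : nat, 'I_n -> upto d -> dom c).
Hypothesis hKmeas : measurable_fun setT (fun z : dom c * dom c => K z.1 z.2).
Hypothesis Ksym : forall a b, K a b = K b a.
Hypothesis hKc : K c c = 0.
Hypothesis hM : (\int[rho]_a (K a a)%:E < +oo)%E.
Hypothesis hC0 : 0 < double_mean K rho.
Hypothesis hmu : is_product_measure rho mu.
Hypothesis hrhoU : forall u : {fset nat}, is_product_measure rho (rhoU u).
Hypothesis hgamma0 : forall u, 0 <= gamma u.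
Hypothesis hgammaM :
  (\esum_(u in setT) (gamma u * diag_mean K rho ^+ #|` u|%fset)%:E < +oo)%E.
Hypothesis hcost1 : forall k, 1 <= cost k.
Hypothesis hcostmono : forall k l, (k <= l)%N -> cost k <= cost l.
Hypothesis hs : 0 <= s.
Hypothesis hcostO : cost =O_\oo (fun k : nat => k%:R `^ s).
Hypothesis hWdim : separable_by W d.
Hypothesis hWgamma : (active gamma `<=` W)%classic.
Hypothesis hc1 : 0 <= c1.
Hypothesis hC : 0 <= C.
Hypothesis hbeta1 : 0 <= beta1.
Hypothesis hbeta2 : 0 <= beta2.
Hypothesis hQ : forall n : nat, (0 < n)%N ->
    forall (u : {fset nat}) (ud : (u `<=` upto d)%fset),
    (worst_case_error (HU u) (integral_u (rhoU u)) (quad_u (a (n:=n)) (t (n:=n)) ud)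
     <= (c1 * C ^+ #|` u|%fset * n.+1%:R `^ (- alpha)
         * (1 + ln n.+1%:R) `^ (beta1 * (#|` u|%fset)%:R + beta2))%:E)%E.

Lemma active_card u : active gamma u -> (#|` u| <= d)%N.
Proof.
move=> /hWgamma Wu; have [phi /(_ _ Wu) phi_inj] := hWdim.
have <- : #|` [fset (phi j : nat) | j in u]| = #|` u|.
  by apply: card_in_imfset => i j iu ju /val_inj; exact: phi_inj.
rewrite -[leqRHS](card_upto d); apply: fsubset_leq_card; apply/fsubsetP => j /imfsetP[i _ ->].
by rewrite !inE mem_iota add0n /=.
Qed.

Lemma level_nodes_error (theta : R) : theta < alpha ->
  exists (z : forall n : nat, 'I_n -> nat -> dom c), exists2 B : R, 0 <= B &
  forall n u, (0 < n)%N -> active gamma u ->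
    sq_error K rho u (level_nodes a z n) <= (B * n.+1%:R `^ (- theta)) ^+ 2.
Proof.
move=> ta; have [phi hphi] := hWdim.
have [B B0 HB] := @error_bound_absorb R c1 C alpha beta1 beta2 theta d hc1 hC hbeta1 hbeta2 ta.
(* Coordinate j of the infinite point copies coordinate [phi j] of the given node, so the same
   points serve all active sets. *)
exists (fun n i j => anchored (t (n:=n) i) (phi j)), B => // n u n0 /hWgamma Wu.
pose f (j : nat) : nat := phi j.
pose w : {fset nat} := f @` u.
have wd : w `<=` upto d.
  by apply/fsubsetP => j /imfsetP[i _ ->]; rewrite !inE mem_iota add0n /f ltn_ord.
have wcard : (#|` w| <= d)%N by rewrite -[leqRHS](card_upto d); exact: fsubset_leq_card.
rewrite /level_nodes (sq_error_reindex K rho (phi := f) _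
  (z := fun i => anchored (t (n:=n) i \o fincl wd))).
- have E0 : 0 <= B * n.+1%:R `^ (- theta) by rewrite mulr_ge0// powR_ge0.
  have le : (worst_case_error (HU w) (integral_u (rhoU w)) (quad_u (a (n:=n)) (t (n:=n)) wd)
      <= (B * n.+1%:R `^ (- theta))%:E)%E.
    by apply: le_trans (hQ n0 wd) _; rewrite lee_fin; exact: HB.
  exact: (sq_error_quad_u hKmeas Ksym hM (@hrhoU w) E0 le).
- by move=> i j iu ju /val_inj; exact: (hphi _ Wu i j iu ju).
- move=> i j ju; rewrite anchored_fincl//.
  by apply/imfsetP; exists j.
Qed.

Lemma tractability_of_decay (p q : R) : 0 < p -> p^-1 < alpha -> 0 < q ->
  ((1 + q)%:E < decay gamma (double_mean K rho))%E -> Num.min 1 s < q * p / 2 ->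
  exists2 B : R, 0 <= B & forall e : R, 0 < e ->
    (comp_unr mu Hgamma cost e <= (B * e `^ (- p))%:E)%E.
Proof.
move=> p0 pa q0 hq; set sigma := Num.min 1 s; set tau := q * p / 2 => st.
have sigma0 : 0 <= sigma by rewrite le_min ler01.
have tau0 : 0 < tau by exact: le_lt_trans st.
have [z [B B0 HB]] := level_nodes_error pa.
have [l [S [c0 [Z [SE Scard HZ]]]]] := block_index_exists hgamma0 hC0 active_card (ltW q0) hq.
have [lev [ls [CL [CL0 levl hcov hcost]]]] : level_statement cost (active gamma) l sigma.
  rewrite /sigma; case: leP => _.
    exact: (levels_by_sets hcost1 hcostmono active_card SE Scard).
  exact: (levels_by_unions hcost1 hcostmono hs hcostO active_card SE Scard).
(* Per level: [g] is the gain in squared error, [b] the growth of the number of nodes, and [w] the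
   gain in error, with w^2 = 1 / g. *)
pose g := 2 `^ q : R; pose b := 2 `^ tau : R; pose w := 2 `^ (- (q / 2)) : R.
have two1 : 1 <= 2 :> R by rewrite ler1n.
have g1 : 1 <= g by rewrite /g -[leLHS](powRr0 2) ler_powR// ltW.
have g0 : 0 < g by exact: lt_le_trans g1.
have b1 : 1 <= b by rewrite /b -[leLHS](powRr0 2) ler_powR// ltW.
have b0 : 0 < b by exact: lt_le_trans b1.
have w0 : 0 < w by rewrite powR_gt0.
have w1 : w < 1.
  rewrite -ltr_ln ?posrE// ln1 ln_powR mulNr oppr_lt0 mulr_gt0 ?divr_gt0//.
  by rewrite ln_gt0// ltr1n.
have wg : w ^+ 2 = g^-1.
  rewrite -powR_mulrn ?(ltW w0)// -powRrM -powRN; congr (_ `^ _); by field.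
(* Positive, as the quadrature bounds require, and comparable with b^j from both sides. *)
pose nn j := (Num.truncn (b ^+ j)).+1.
have nn_ge j : b ^+ j <= (nn j).+1%:R.
  have /andP[_ h] := truncn_itv (exprn_ge0 j (ltW b0)).
  by apply: (le_trans (ltW h)); rewrite ler_nat.
have nn_le j : (nn j)%:R <= 2 * b ^+ j.
  have /andP[h _] := truncn_itv (exprn_ge0 j (ltW b0)).
  by rewrite /nn -natr1 mulr2n mulrDl mul1r lerD// exprn_ege1.
have bE j : b ^+ j = 2 `^ (tau * j%:R) by rewrite powRrM powR_mulrn// ltW.
have gE j : g ^+ j = 2 `^ (q * j%:R) by rewrite powRrM powR_mulrn// ltW.
(* This balance dictates tau = q p / 2: at rate 1 / p, b^j nodes give squared error g^(-j). *)
have bg j : ((b ^+ j) `^ (- p^-1)) ^+ 2 = g ^- j.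
  rewrite bE gE -powRrM -powR_mulrn ?powR_ge0// -powRrM -powRN; congr (_ `^ _).
  by rewrite /tau; field; rewrite gt_eqF.
(* Covers both the quadrature constant of a recovered component and the initial error C_0^|u| of an
   unrecovered one. *)
pose Cst := Num.max (B ^+ 2) (Num.max 1 (double_mean K rho) ^+ d).
have Cst0 : 0 <= Cst by rewrite le_max sqr_ge0.
have M1 : 1 <= Num.max 1 (double_mean K rho) by rewrite le_max lexx.
have mean_le u : active gamma u -> double_mean K rho ^+ #|` u| <= Cst.
  move=> Au; apply: (@le_trans _ _ (Num.max 1 (double_mean K rho) ^+ d)); last by rewrite le_max lexx orbT.
  apply: (@le_trans _ _ (Num.max 1 (double_mean K rho) ^+ #|` u|)).
    by apply: lerXn2r; rewrite ?nnegrE ?le_max ?ler01 ?lexx ?(ltW hC0) ?orbT.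
  by apply: ler_weXn2l => //; exact: active_card.
have sq0 u : sq_error K rho u [::] = double_mean K rho ^+ #|` u|.
  by rewrite /sq_error !big_nil mulr0 subr0 addr0.
pose rr L := multilevel ls nn a z L.
pose nodes (rs : seq (R * {fset nat} * (nat -> dom c))) := [seq (e.1.1, anchor_at e.1.2 e.2) | e <- rs].
have sq_le L u : active gamma u ->
    sq_error K rho u (nodes (rr L)) <= Cst * ((2 ^+ l u) `^ q * g ^- L).
  move=> Au; rewrite powR2X -/g (sq_error_multilevel rho HU Ksym hKc nn a z L (fun k => hcov k u Au)).
  have lul := levl u Au.
  case: leqP => [lL|Ll].
    apply: le_trans (HB _ u _ Au) _ => //; rewrite exprMn.
    apply: ler_pM; rewrite ?sqr_ge0//; first by rewrite le_max lexx.
    apply: (@le_trans _ _ (g ^- (L - lev u))).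
      rewrite -bg lerXn2r ?nnegrE ?powR_ge0// !powRN lef_pV2 ?posrE ?powR_gt0 ?exprn_gt0//.
      by apply: ge0_ler_powR; rewrite ?nnegrE ?invr_ge0 ?exprn_ge0 ?(ltW p0) ?(ltW b0).
    rewrite -(ler_pM2r (exprn_gt0 L g0)) mulfVK ?gt_eqF ?exprn_gt0//.
    rewrite -{2}(subnK lL) exprD mulKf ?gt_eqF ?exprn_gt0//.
    exact: ler_weXn2l.
  rewrite sq0 -[leLHS]mulr1; apply: ler_pM => //.
  - by rewrite exprn_ge0// ltW.
  - exact: mean_le.
  - rewrite ler_pdivlMr ?exprn_gt0// mul1r; apply: ler_weXn2l => //.
    exact: leq_trans (ltnW Ll) lul.
have Z0 : 0 <= Z by have := HZ [::] isT; rewrite big_nil; apply.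
(* The summand 1 makes [E0] positive, as needed for dividing by it. *)
pose E0 := Num.sqrt (Cst * Z) + 1.
have E0p : 0 < E0 by rewrite ltr_wpDl// sqrtr_ge0.
have E0sq : Cst * Z <= E0 ^+ 2.
  rewrite -[leLHS](@sqr_sqrtr _ (Cst * Z)) ?mulr_ge0//.
  by apply: lerXn2r; rewrite ?nnegrE ?sqrtr_ge0 ?(ltW E0p)// lerDl.
have nodesX rs p1 : p1 \in map snd (nodes rs) -> weighted_domain K gamma p1.
  move=> /mapP[_ /mapP[e _ ->] ->] /=.
  by apply: (weighted_domain_finite_support HU hKc hgamma0 (v := e.1.2)) => j /negbTE; rewrite /anchor_at => ->.
have sum_le N (F : {fset nat} -> R) (y : R) : 0 <= y ->
    (forall u, active gamma u -> F u <= Cst * ((2 ^+ l u) `^ q * y)) ->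
    \sum_(u <- enum_below (active gamma) N) gamma u * F u <= Cst * Z * y.
  move=> y0 FC.
  apply: (@le_trans _ _ (\sum_(u <- enum_below (active gamma) N) (Cst * y) * (gamma u * (2 ^+ l u) `^ q))).
    rewrite big_seq [leRHS]big_seq; apply: ler_sum => u uN.
    apply: (le_trans (ler_wpM2l (hgamma0 u) (FC u (enum_below_sub uN)))).
    by rewrite le_eqVlt; apply/orP; left; apply/eqP; ring.
  rewrite -mulr_sumr [leRHS]mulrAC ler_wpM2l ?mulr_ge0//.
  by apply: HZ; [exact: enum_below_uniq | move=> u; exact: enum_below_sub].
have errL L : (alg_error mu Hgamma (list_algorithm (rr L)) <= (E0 * w ^+ L)%:E)%E.
  apply: (alg_error_le Hgamma HU hKmeas Ksym hKc hM hmu hgamma0 hgammaM (r := nodes (rr L))).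
  - by move=> f; exact: list_algorithm_apply.
  - exact: nodesX.
  - by rewrite mulr_ge0 ?exprn_ge0 ?ltW.
  - move=> N; apply: (le_trans (sum_le N _ (g ^- L) _ _)).
    + by rewrite invr_ge0 exprn_ge0// ltW.
    + exact: sq_le.
    + by rewrite exprMn -exprM mulnC exprM wg exprVn ler_wpM2r// invr_ge0 exprn_ge0// ltW.
(* For e >= E0 the bound B e^(-p) may drop below the cost of a single evaluation, so the algorithm
   without nodes is needed there. *)
have err0 : (alg_error mu Hgamma (list_algorithm (c := c) [::]) <= E0%:E)%E.
  apply: (alg_error_le Hgamma HU hKmeas Ksym hKc hM hmu hgamma0 hgammaM (r := nodes [::])).
  - by move=> f; exact: list_algorithm_apply.
  - exact: nodesX.
  - exact: ltW.
  - move=> N; apply: (le_trans (sum_le N _ 1 ler01 _)); last by rewrite mulr1.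
    move=> u Au; rewrite mulr1 sq0 -[leLHS]mulr1; apply: ler_pM => //.
    + by rewrite exprn_ge0// ltW.
    + exact: mean_le.
    + by rewrite powR2X exprn_ege1.
(* The ratio of the cost bounds of consecutive levels; x < 1 is the hypothesis sigma < tau. *)
pose x := 2 `^ sigma / b.
have x0 : 0 <= x by rewrite divr_ge0 ?powR_ge0 ?ltW.
have x1 : x < 1.
  rewrite ltr_pdivrMr// mul1r -ltr_ln ?posrE ?powR_gt0// !ln_powR ltr_pM2r//.
  by rewrite ln_gt0// ltr1n.
pose C3 := 2 * CL / (1 - x).
have C30 : 0 <= C3 by rewrite divr_ge0 ?mulr_ge0// subr_ge0 ltW.
have costL L : cost_unr cost (list_algorithm (rr L)) <= C3 * b ^+ L.
  apply: (le_trans (list_algorithm_cost _ hcostmono)); rewrite multilevel_cost big_mkord.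
  apply: (@le_trans _ _ (\sum_(k < L.+1) (2 * CL * b ^+ L) * x ^+ k)).
    apply: ler_sum => k _.
    apply: (@le_trans _ _ ((2 * b ^+ (L - k)) * (CL * (2 ^+ k) `^ sigma))).
      apply: ler_pM => //; apply: sumr_ge0 => e _; exact: le_trans (hcost1 _).
    have kL : (k <= L)%N by rewrite -ltnS.
    have -> : b ^+ L = b ^+ (L - k) * b ^+ k by rewrite -exprD subnK.
    rewrite powR2X /x expr_div_n.
    rewrite le_eqVlt; apply/orP; left; apply/eqP; field.
    by rewrite gt_eqF// exprn_gt0.
  rewrite -mulr_sumr /C3 [leRHS]mulrAC ler_wpM2l ?mulr_ge0 ?exprn_ge0 ?(ltW b0)//.
  exact: geometric_sum_le.
have comp_le Q (e y : R) : (alg_error mu Hgamma Q <= e%:E)%E -> cost_unr cost Q <= y ->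
    (comp_unr mu Hgamma cost e <= y%:E)%E.
  move=> Qe Qy; apply: (@le_trans _ _ (cost_unr cost Q)%:E); last by rewrite lee_fin.
  by apply: ereal_inf_lbound; exists Q.
(* Cost b^L and error w^L are related by the power -p: again the choice of tau. *)
have bw L : b ^+ L = (w ^+ L) `^ (- p).
  rewrite bE -powR_mulrn ?(ltW w0)// -!powRrM; congr (_ `^ _).
  by rewrite /tau; field.
have F0 : 0 <= C3 * b * E0 `^ p.
  by apply: mulr_ge0; [apply: mulr_ge0 => //; exact: ltW | exact: powR_ge0].
clearbody C3.
exists (C3 * b * E0 `^ p); first exact: F0.
move=> e e0; have [Ee|eE] := leP E0 e.
  apply: (comp_le (list_algorithm (c := c) [::])).
    by apply: (le_trans err0); rewrite lee_fin.
  by rewrite /cost_unr /= big_ord0 mulr_ge0// powR_ge0.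
have exL : exists L, E0 * w ^+ L <= e.
  have cw : w ^+ n @[n --> \oo] --> (0 : R) by apply: cvg_expr; rewrite ger0_norm ?(ltW w0).
  have eE0 : 0 < e / E0 by rewrite divr_gt0.
  have /cvgrPdist_lt/(_ _ eE0)[N _ HN] := cw.
  exists N; have := HN N (leqnn _); rewrite /= sub0r normrN ger0_norm ?exprn_ge0 ?(ltW w0)// ltr_pdivlMr// mulrC.
  exact: ltW.
(* For the least sufficient number of levels, one level less misses [e]; this bounds the cost from
   above, and the extra level accounts for the factor [b] in the constant. *)
case: (ex_minnP exL) => -[|L] Le Lmin.
  by move: Le; rewrite expr0 mulr1 leNgt eE.
have Lb : e < E0 * w ^+ L by rewrite ltNge; apply/negP => /Lmin; rewrite ltnn.
apply: (comp_le (list_algorithm (rr L.+1))).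
  by apply: (le_trans (errL _)); rewrite lee_fin.
apply: (le_trans (costL _)); rewrite exprS -!mulrA; apply: ler_wpM2l => //.
apply: ler_wpM2l; first exact: ltW.
rewrite bw; apply: (@le_trans _ _ ((e / E0) `^ (- p))).
  rewrite !powRN lef_pV2 ?posrE ?powR_gt0 ?divr_gt0 ?exprn_gt0//.
  apply: ge0_ler_powR; rewrite ?nnegrE ?exprn_ge0 ?divr_ge0 ?ltW//.
  by rewrite ltr_pdivrMr// mulrC.
rewrite powRM ?invr_ge0 ?(ltW e0) ?(ltW E0p)// mulrC.
by rewrite -(powR_inv1 (ltW E0p)) -powRrM mulrNN mul1r lexx.
Qed.

End tractability_bound.

Close Scope fset_scope.
Theorem theorem9
  (R : realType) (D : set R) (c : D) (K : dom c -> dom c -> R)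
  (rho : probability (dom c) R)
  (mu : probability (powT nat (dom c)) R)
  (rhoU : forall u : {fset nat}, probability (powT u (dom c)) R)
  (gamma : {fset nat} -> R)
  (HU : forall u : {fset nat}, rkhs (prodK K u))
  (Hgamma : rkhs (@weighted_kernel R D c K gamma))
  (cost : nat -> R) (s : R)
  (W : set {fset nat}) (d : nat)
  (alpha c1 C beta1 beta2 : R)
  (a : forall n : nat, 'I_n -> R)
  (t : forall n : nat, 'I_n -> upto d -> dom c)
  (hD : measurable (D : set (measurableTypeR R)))
  (hKmeas : measurable_fun setT (fun z : dom c * dom c => K z.1 z.2))
  (hKpsd : psd_kernel K)
  (hKnz : exists x y, K x y != 0)
  (hKc : K c c = 0)
  (hM : (\int[rho]_x (K x x)%:E < +oo)%E)
  (hC0 : 0 < double_mean K rho)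
  (hmu : is_product_measure rho mu)
  (hrhoU : forall u : {fset nat}, is_product_measure rho (rhoU u))
  (hgamma0 : forall u, 0 <= gamma u)
  (hgammaM :
    (\esum_(u in setT) (gamma u * diag_mean K rho ^+ #|` u|%fset)%:E < +oo)%E)
  (hgammane : exists2 u, active gamma u & u != fset0)
  (hcost1 : forall k, 1 <= cost k)
  (hcostmono : forall k l, (k <= l)%N -> cost k <= cost l)
  (hs : 0 <= s)
  (hcostO : cost =O_\oo (fun k : nat => k%:R `^ s))
  (hgammadim : finite_algorithmic_dimension (active gamma))
  (hdecay : (1 < decay gamma (double_mean K rho))%E)
  (hWdim : algorithmic_dimension W d)
  (hWgamma : active gamma `<=` W)
  (halpha : 0 < alpha)
  (hc1 : 0 <= c1) (hC : 0 <= C) (hbeta1 : 0 <= beta1) (hbeta2 : 0 <= beta2)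
  (hQ : forall n : nat, (0 < n)%N ->
    forall (u : {fset nat}) (ud : (u `<=` upto d)%fset),
    (worst_case_error (HU u) (integral_u (rhoU u)) (quad_u (a n) (t n) ud)
     <= (c1 * C ^+ #|` u|%fset * n.+1%:R `^ (- alpha)
         * (1 + ln n.+1%:R) `^ (beta1 * (#|` u|%fset)%:R + beta2))%:E)%E) :
  (exponent_unr mu Hgamma cost
   <= maxe (alpha^-1)%:E
           ((2 * Num.min 1 s)%:E / (decay gamma (double_mean K rho) - 1)))%E.
Proof.
set dec := decay _ _ in hdecay *; set sigma := Num.min 1 s.
have a0 : 0 < alpha^-1 by rewrite invr_gt0.
have sigma0 : 0 <= sigma by rewrite le_min ler01.
have key (p : R) : (maxe (alpha^-1)%:E ((2 * sigma)%:E / (dec - 1)) < p%:E)%E ->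
    (exponent_unr mu Hgamma cost <= p%:E)%E.
  rewrite gt_max lte_fin => /andP[ap sp].
  have p0 : 0 < p by exact: lt_trans ap.
  have [q [q0 hq hsq]] : exists q : R, [/\ 0 < q, ((1 + q)%:E < dec)%E & sigma < q * p / 2].
    move: hdecay sp; case: dec => [r|_ _|//].
      rewrite lte_fin => r1; rewrite -EFinB inver subr_eq0 gt_eqF// -EFinM lte_fin => sp.
      pose m := 2 * sigma / p.
      have m0 : 0 <= m by rewrite divr_ge0 ?mulr_ge0 ?(ltW p0).
      have mD : m < r - 1.
        by move: sp; rewrite /m !ltr_pdivrMr ?subr_gt0// [p * _]mulrC.
      (* The midpoint of the admissible interval between 2 sigma / p and decay - 1. *)
      exists ((m + (r - 1)) / 2); split.
      - by rewrite divr_gt0// ltr_wpDl// subr_gt0.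
      - by rewrite lte_fin; lra.
      - have h : m < (m + (r - 1)) / 2 by lra.
        move: h; rewrite {1}/m ltr_pdivrMr// mulrC => h; rewrite ltr_pdivlMr//.
    (* For infinite decay only the lower constraint on q remains. *)
    exists (2 * sigma / p + 1); split.
    - by rewrite ltr_wpDl// divr_ge0 ?mulr_ge0 ?(ltW p0).
    - exact: ltry.
    - rewrite ltr_pdivlMr// mulrDl mulfVK ?gt_eqF// mul1r mulrC ltrDl//.
  apply: ereal_inf_lbound; exists p => //; split; first exact: ltW.
  apply: (tractability_of_decay Hgamma hKmeas hKpsd.1 hKc hM hC0 hmu hrhoU hgamma0 hgammaM
    hcost1 hcostmono hs hcostO _ hWgamma hc1 hC hbeta1 hbeta2 hQ p0 _ q0 hq hsq).
  - by have [] := hWdim.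
  - by rewrite -[ltRHS]invrK ltf_pV2 ?posrE.
case E : (maxe _ _) => [m| |]; last 2 first.
- exact: leey.
- have : ((alpha^-1)%:E <= maxe (alpha^-1)%:E ((2 * sigma)%:E / (dec - 1)))%E by rewrite le_max lexx.
  by rewrite E.
(* [key] requires p strictly above the bound, so the bound is reached as a limit. *)
apply/lee_addgt0Pr => e e0; rewrite -EFinD; apply: key.
by rewrite E lte_fin ltrDl.
Qed.
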